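(* For each positive integer $j$ involved below, let $P_{2j}$ be a convex polygon in $\mathbb{R}^2$ with exactly $2j$ vertices, all lying on the unit circle $S^1$, one of them being $(1,0)$, such that $P_{2j}$ is centrally symmetric about $0$ and is symmetric under the reflection $(x,y)\mapsto(x,-y)$. Let $d\ge1$ and $n=\frac12d(d+1)$. If $d=2k$, identify $\mathbb{R}^{2k}=\prod_{j=1}^k\mathbb{R}^2$, and let $\{\pm v_1,\dots,\pm v_n\}\subset\mathbb{R}^{2k}$ be the union over $j=1,\dots,k$ of the vertex set of $P_{2(4j-1)}$ placed in the $j$-th factor $\mathbb{R}^2$ (with all other coordinates equal to $0$). If $d=2k+1$, identify $\mathbb{R}^{2k+1}=\mathbb{R}\times\prod_{j=1}^k\mathbb{R}^2$, and let $\{\pm v_1,\dots,\pm v_n\}\subset\mathbb{R}^{2k+1}$ be the union of $\{\pm1\}$ placed in the factor $\mathbb{R}$ and, over $j=1,\dots,k$, of the vertex set of $P_{2(4j+1)}$ placed in the $j$-th factor $\mathbb{R}^2$ (with all other coordinates equal to $0$). Then $K^d(v_1,\dots,v_n)$ is a universal cover.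
   Context: A convex set $K\subset\mathbb{R}^d$ is a universal cover if for every set $X\subset\mathbb{R}^d$ of diameter $1$ there exist $A\in O(d)$ and $b\in\mathbb{R}^d$ such that $X\subset A(K)+b$. $K^d(v_1,\dots,v_n):=\{x\in\mathbb{R}^d:\ |\langle x,v_i\rangle|\le\frac12\|v_i\|\text{ for all }i\}$. *)

(* Defs.v *)
From HB Require Import structures.
From mathcomp Require Import all_boot all_order all_algebra.
From mathcomp Require Import all_classical all_reals.
From mathcomp Require Import ereal convex.

Set Implicit Arguments.
Unset Strict Implicit.
Unset Printing Implicit Defensive.

Import Order.TTheory GRing.Theory Num.Theory.

Local Open Scope classical_set_scope.
Local Open Scope ring_scope.

(* Points of R^d are column vectors. The library norm on matrices is the sup
   norm, hence the separate Euclidean norm [enorm]. *)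
Definition dot (R : realType) (d : nat) (x y : 'cV[R]_d) : R :=
  \sum_(i < d) x i 0 * y i 0.

Definition enorm (R : realType) (d : nat) (x : 'cV[R]_d) : R :=
  Num.sqrt (dot x x).

(* Extended-real valued: -oo on the empty set, +oo on unbounded sets. *)
Definition diam (R : realType) (d : nat) (X : set 'cV[R]_d) : \bar R :=
  ereal_sup [set (enorm (x - y))%:E | x in X & y in X].

Definition orthogonal_mx (R : realType) (d : nat) (A : 'M[R]_d) : Prop :=
  A^T *m A = 1%:M.

Definition universal_cover (R : realType) (d : nat) (K : set 'cV[R]_d) : Prop :=
  convex_set K /\
  forall X : set 'cV[R]_d, diam X = 1%:E ->
    exists (A : 'M[R]_d) (b : 'cV[R]_d),
      orthogonal_mx A /\ X `<=` [set A *m x + b | x in K].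

Definition slabs (R : realType) (d n : nat) (v : 'I_n -> 'cV[R]_d) :
    set 'cV[R]_d :=
  [set x | forall i : 'I_n, `|dot x (v i)| <= 2^-1 * enorm (v i)].

Definition plus_minus (R : realType) (d n : nat) (v : 'I_n -> 'cV[R]_d) :
    set 'cV[R]_d :=
  [set x | exists i : 'I_n, x = v i \/ x = - v i].

(* Extreme points. *)
Definition vertices (R : realType) (d : nat) (P : set 'cV[R]_d) :
    set 'cV[R]_d :=
  [set x | P x /\
    forall (y z : 'cV[R]_d) (t : R), P y -> P z -> 0 < t < 1 ->
      x = t *: y + (1 - t) *: z -> y = x /\ z = x].

(* The convex hull of a finite set. Degenerate hulls are allowed, but they have
   at most two vertices. *)
Definition convex_polygon (R : realType) (P : set 'cV[R]_2) : Prop :=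
  exists2 S : set 'cV[R]_2,
    finite_set S & P = smallest (@convex_set R 'cV[R]_2) S.

(* (x, y) |-> (x, - y) *)
Definition reflection (R : realType) (x : 'cV[R]_2) : 'cV[R]_2 :=
  \col_i ((-1) ^+ i * x i 0).

(* [delta_mx 0 0] is the point (1, 0). *)
Definition inscribed_symmetric_polygon (R : realType) (m : nat)
    (P : set 'cV[R]_2) : Prop :=
  convex_polygon P /\
  (vertices P #= `I_m)%card /\
  (forall x, vertices P x -> enorm x = 1) /\
  vertices P (delta_mx 0 0) /\
  (forall x, P x -> P (- x)) /\
  (forall x, P x -> P (reflection x)).

(* The vector of R^d whose coordinates o, ..., o + m - 1 (counted from 0) are
   those of w and whose other coordinates are 0 (meant for o + m <= d). *)
Definition place (R : realType) (d m : nat) (o : nat) (w : 'cV[R]_m) :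
    'cV[R]_d :=
  \col_(i < d) \sum_(l < m | (i == o + l :> nat)%N) w l 0.

Definition vertices_even (R : realType) (d : nat) (P : nat -> set 'cV[R]_2)
    (k : nat) : set 'cV[R]_d :=
  \bigcup_(j in [set j : nat | (1 <= j <= k)%N])
    (place d (2 * (j - 1)) @` vertices (P (2 * (4 * j - 1))%N)).

Definition vertices_odd (R : realType) (d : nat) (P : nat -> set 'cV[R]_2)
    (k : nat) : set 'cV[R]_d :=
  (place d 0 @` [set (const_mx 1 : 'cV[R]_1); const_mx (-1)]) `|`
  \bigcup_(j in [set j : nat | (1 <= j <= k)%N])
    (place d (1 + 2 * (j - 1)) @` vertices (P (2 * (4 * j + 1))%N)).

(* Main.v *)
(* Let h be the support function of X and g u := (h u - h (- u)) / 2.  The strip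
   |<x, u> - g u| <= |u| / 2 contains X, so it suffices to find an orthonormal
   frame A and a point c such that g (A v_i) = <c, A v_i> for all i.  The planes
   are chosen one after the other, the largest polygon first.  For a frame
   (x, y) of such a plane, reflecting the polygon splits the equations for its
   4 m + 2 vertices into m functions that are odd in x and even in y and m - 1
   functions that are even in x and odd in y.  Together with the orthogonality
   to the planes already chosen and to each other, this gives d - 1 functions of
   the first kind, d - 2 of the second kind and <x, y>, which is odd in both.

   Such a system has a zero on S^(d-1) x S^(d-1), because the coefficient of
   s^(d-1) t^(d-1) in s^(d-1) (s + t) t^(d-2) is odd.  This is proved with
   mod 2 chains: each function gives a 0-cochain, its sign at the vertices of a
   fine triangulation; if no cell carried sign changes of all functions, the
   product of the coboundaries would vanish on the fundamental domain of the
   action of the two antipodal maps, but Stokes' formula evaluates it to the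
   coefficient above. *)
Require Import Defs.
From mathcomp Require Import all_boot all_order all_algebra finmap.
From mathcomp Require Import all_classical all_reals.
From mathcomp Require Import ereal convex interval_inference topology normedtype.
From mathcomp Require Import sequences realfun zify ring lra.

Set Implicit Arguments.
Unset Strict Implicit.
Unset Printing Implicit Defensive.

Import Order.TTheory GRing.Theory Num.Theory.
Import numFieldNormedType.Exports.

Local Open Scope classical_set_scope.
Local Open Scope ring_scope.

Local Notation "\xor_ ( i <- r ) F" := (\big[addb/false]_(i <- r) F)
  (at level 41, F at level 41, i, r at level 50).

(** * Cochains on pairs of ordered simplices *)

(* Faces are augmented: the empty simplex is the face of a point. Chains and
   cochains of points only pair correctly with functions vanishing on [::]. *)
Fixpoint faces (V : Type) (xs : seq V) : seq (seq V) :=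
  if xs is x :: xs' then xs' :: [seq x :: f | f <- faces xs'] else [::].

Section Faces.
Variables V : Type.
Implicit Types (xs ys : seq V).

Lemma faces_map (W : Type) (a : V -> W) xs :
  faces (map a xs) = [seq map a f | f <- faces xs].
Proof. by elim: xs => //= x xs ->; rewrite -!map_comp. Qed.

Definition bdry (F : seq V -> bool) xs := \xor_(f <- faces xs) F f.

Lemma bdry_cons F x xs : bdry F (x :: xs) = F xs (+) bdry (fun f => F (x :: f)) xs.
Proof. by rewrite /bdry /= big_cons big_map. Qed.

Lemma bdry_add F G xs : bdry (fun f => F f (+) G f) xs = bdry F xs (+) bdry G xs.
Proof. exact: big_split. Qed.

Lemma bdry_bdry F xs : bdry (bdry F) xs = false.
Proof.
elim: xs F => [|x xs IH] F; first by rewrite /bdry big_nil.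
rewrite bdry_cons.
have -> : bdry (fun f => bdry F (x :: f)) xs =
  bdry (fun f => F f (+) bdry (fun g => F (x :: g)) f) xs.
  by apply: eq_bigr => f _; rewrite bdry_cons.
by rewrite bdry_add IH addbF addbb.
Qed.

Lemma bdry_map (a : V -> V) F xs : bdry F (map a xs) = bdry (fun f => F (map a f)) xs.
Proof. by rewrite /bdry faces_map big_map. Qed.

End Faces.

Lemma bdryC (V : Type) (F : seq V -> seq V -> bool) xs ys :
  bdry (fun f => bdry (F f) ys) xs = bdry (fun g => bdry (fun f => F f g) xs) ys.
Proof. exact: exchange_big. Qed.

Lemma faces_sub (V : eqType) (xs f : seq V) :
  f \in faces xs -> {subset f <= xs} /\ (size f).+1 = size xs.
Proof.
elim: xs f => //= x xs IH f; rewrite inE => /orP[/eqP->|/mapP[g /IH[sg eg] ->]].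
  by split=> // y yf; rewrite inE yf orbT.
split=> [y|/=]; last by rewrite eg.
by rewrite !inE => /orP[->//|/sg->]; rewrite orbT.
Qed.

Section Cochains.
Variable V : eqType.
Variable a : V -> V.
Implicit Types (xs ys : seq V) (F : seq V -> seq V -> bool).

Definition bdry2 F xs ys := bdry (F^~ ys) xs (+) bdry (F xs) ys.

Lemma bdry2_bdry2 F xs ys : bdry2 (bdry2 F) xs ys = false.
Proof.
rewrite /bdry2 !bdry_add bdry_bdry addFb (bdry_bdry (F xs)) addbF.
by rewrite -(bdryC F) addbb.
Qed.

Lemma eq_in_bdry2 F G xs ys : {in faces xs, forall f, F f ys = G f ys} ->
  {in faces ys, F xs =1 G xs} -> bdry2 F xs ys = bdry2 G xs ys.
Proof. by move=> e1 e2; rewrite /bdry2; congr (_ (+) _); apply: eq_big_seq. Qed.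

(** The cup product of the 0-cochain [s] with [F], read off at the leading vertices. *)
Definition weight (s : V -> V -> bool) F xs ys :=
  if xs is x :: _ then if ys is y :: _ then s x y && F xs ys else false
  else false.

(* The product of the coboundaries of the functions in [l], computed on products
   of simplices as d(s_1 d(s_2 ... d(s_m 1))). *)
Fixpoint cocycle (l : seq (V -> V -> bool)) xs ys : bool :=
  if l is s :: l' then bdry2 (weight s (cocycle l')) xs ys
  else (size xs == 1%N) && (size ys == 1%N).

(** The first two claims keep the augmented face of a point from contributing. Closedness for the
    empty list of functions says that an edge has two ends; otherwise it is [bdry2_bdry2]. *)
Lemma bdry2_cocycle l xs ys : cocycle l [::] ys = false /\ cocycle l xs [::] = false
  /\ bdry2 (cocycle l) xs ys = false.
Proof.
case: l => [|s l] /=.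
  split=> //; split; first by rewrite andbF.
  rewrite /bdry2 /bdry.
  have E (zs : seq V) b : \xor_(f <- faces zs) ((size f == 1%N) && b) = false.
    case: (eqVneq (size zs) 2) => [|zs2].
      case: zs => [|x [|y []]] //=; rewrite !big_cons big_nil /=; by case: b.
    rewrite big1_seq // => f /= /faces_sub[_ e].
    by move: zs2; rewrite -e; case: (size f) => [|[]].
  rewrite E addFb.
  by under eq_bigr do rewrite andbC; rewrite E.
split; last split; last exact: bdry2_bdry2.
- by rewrite /bdry2 /bdry /= big_nil big1.
- rewrite /bdry2 /bdry /= big_nil addbF big1_seq // => f _.
  by rewrite /weight; case: f.
Qed.

Lemma weight_const s F c xs ys :
  (forall zs, F [::] zs = false) -> (forall zs, F zs [::] = false) ->
  {in xs & ys, forall x y, s x y = c} ->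
  weight s F xs ys = c && F xs ys.
Proof.
move=> F1 F2; case: xs => [|x xs]; first by rewrite F1 andbF.
case: ys => [|y ys] /=; first by rewrite F2 andbF.
by move=> ->; rewrite ?inE ?eqxx.
Qed.

Lemma bdry2_scale c F xs ys : bdry2 (fun f g => c && F f g) xs ys = c && bdry2 F xs ys.
Proof. by rewrite /bdry2 /bdry -!big_distrr -andb_addr. Qed.

Lemma bdry2_add F G xs ys :
  bdry2 (fun f g => F f g (+) G f g) xs ys = bdry2 F xs ys (+) bdry2 G xs ys.
Proof. by rewrite /bdry2 !bdry_add addbACA. Qed.

(** Where [s] is constant, its step takes the coboundary of a constant multiple of a closed cochain.
    Functions listed before [s] preserve the vanishing, because [s] is constant on every face as
    well. *)
Lemma cocycle_const (l : seq (V -> V -> bool)) (s : V -> V -> bool) c xs ys : s \in l ->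
  {in xs & ys, forall x y, s x y = c} -> cocycle l xs ys = false.
Proof.
elim: l xs ys => //= t l IH xs ys; rewrite inE => /predU1P[->|sl] sc.
  have [_ [_ l0]] := bdry2_cocycle l xs ys.
  rewrite -(andbF c) -l0 -bdry2_scale; apply: eq_in_bdry2 => [f|g] /faces_sub[sub _];
    apply: weight_const => [zs|zs|x y xf yg].
  1-2, 4-5: by have [? []] := bdry2_cocycle l zs zs.
  1-2: by apply: sc => //; apply: sub.
have W f g : cocycle l f g = false -> weight t (cocycle l) f g = false.
  by move=> lfg; case: f g lfg => [|x f] [|y g] //= ->; rewrite andbF.
by rewrite /bdry2 /bdry !big1_seq // => f /= /faces_sub[sub _]; rewrite W // IH // => x y;
  [move=> xx /sub | move=> /sub xx]; exact: sc.
Qed.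

Lemma cocycle_varies (l : seq (V -> V -> bool)) (s : V -> V -> bool) xs ys :
  s \in l -> cocycle l xs ys ->
  exists p q, [/\ p.1 \in xs, p.2 \in ys, q.1 \in xs, q.2 \in ys &
    s p.1 p.2 && ~~ s q.1 q.2].
Proof.
move=> sl lxy.
have [x0 [y0 [x0x y0y]]] : exists x0 y0, x0 \in xs /\ y0 \in ys.
  case: xs lxy => [|x xs]; first by rewrite (bdry2_cocycle l [::] ys).1.
  case: ys => [|y ys]; first by rewrite (bdry2_cocycle l (x :: xs) [::]).2.1.
  by exists x, y; rewrite !inE !eqxx.
apply: contrapT => N.
suff : cocycle l xs ys = false by rewrite lxy.
apply: (cocycle_const sl (c := s x0 y0)) => x y xx yy.
case E: (s x y); case E0: (s x0 y0) => //; case: N.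
  by exists (x, y), (x0, y0); split => //=; rewrite E E0.
by exists (x0, y0), (x, y); split => //=; rewrite E E0.
Qed.

(** [chi] is the mod 2 character by which [s] transforms under [a] acting on either factor; [true]
    stands for odd. *)
Definition equivar (s : V -> V -> bool) (chi : bool * bool) :=
  (forall x y, s (a x) y = s x y (+) chi.1) /\
  (forall x y, s x (a y) = s x y (+) chi.2).

Lemma weight_mapl s chi F xs ys : equivar s chi ->
  (forall zs, F [::] zs = false) -> (forall zs, F zs [::] = false) ->
  F (map a xs) ys = F xs ys ->
  weight s F (map a xs) ys = weight s F xs ys (+) (chi.1 && F xs ys).
Proof.
move=> [sa _] F1 F2; case: xs => [_|x xs] /=; first by rewrite F1 andbF.
by case: ys => [|y ys] /= => [_|->]; rewrite ?F2 ?andbF // sa andb_addl.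
Qed.

Lemma weight_mapr s chi F xs ys : equivar s chi ->
  (forall zs, F [::] zs = false) -> (forall zs, F zs [::] = false) ->
  F xs (map a ys) = F xs ys ->
  weight s F xs (map a ys) = weight s F xs ys (+) (chi.2 && F xs ys).
Proof.
move=> [_ sa] F1 F2; case: xs => [_|x xs] /=; first by rewrite F1 andbF.
by case: ys => [|y ys] /= => [_|->]; rewrite ?F2 ?andbF // sa andb_addl.
Qed.

(** Applying [a] in one factor changes [s] by a constant, hence [weight s] by a constant multiple of
    the remaining cocycle, whose coboundary is zero. *)
Lemma cocycle_map (l : seq ((V -> V -> bool) * (bool * bool))) xs ys :
  {in l, forall p, equivar p.1 p.2} ->
  cocycle (map fst l) (map a xs) ys = cocycle (map fst l) xs ys /\
  cocycle (map fst l) xs (map a ys) = cocycle (map fst l) xs ys.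
Proof.
elim: l xs ys => [|[s chi] l IH] xs ys lE /=; first by rewrite !size_map.
have sE : equivar s chi by apply: (lE (s, chi)); apply: mem_head.
have {}IH f g : _ /\ _ := IH f g (sub_in1 (@mem_behead _ (_ :: l)) lE).
have l0 f g := bdry2_cocycle (map fst l) f g.
split.
  transitivity (bdry2 (fun f g => weight s (cocycle (map fst l)) f g (+)
                 (chi.1 && cocycle (map fst l) f g)) xs ys).
    rewrite /bdry2 bdry_map; congr (_ (+) _); apply: eq_bigr => f _;
    by apply: weight_mapl; rewrite ?(IH _ _).1 // => zs; have [? []] := l0 zs zs.
  by rewrite bdry2_add bdry2_scale (l0 _ _).2.2 andbF addbF.
transitivity (bdry2 (fun f g => weight s (cocycle (map fst l)) f g (+)
                 (chi.2 && cocycle (map fst l) f g)) xs ys).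
  rewrite /bdry2 bdry_map; congr (_ (+) _); apply: eq_bigr => f _;
  by apply: weight_mapr; rewrite ?(IH _ _).2 // => zs; have [? []] := l0 zs zs.
by rewrite bdry2_add bdry2_scale (l0 _ _).2.2 andbF addbF.
Qed.

Definition pairing (c d : seq (seq V)) F := \xor_(xs <- c) \xor_(ys <- d) F xs ys.

(* Dually, the boundary of [c i.+1] is [c i + a (c i)]: [c i] is a hemisphere of
   dimension [i] and [a] the antipodal map. *)
Definition sphere_chain (c : nat -> seq (seq V)) :=
  (forall G, G [::] = false -> \xor_(xs <- c 0%N) bdry G xs = false) /\
  (forall i G, \xor_(xs <- c i.+1) bdry G xs = \xor_(xs <- c i) (G xs (+) G (map a xs))).

Variable c : nat -> seq (seq V).
Hypothesis cP : sphere_chain c.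

(* Stokes: the cocycle of [s :: l] is the coboundary of [s] times that of [l], and
   on the boundary the translates by [a] cancel up to the character of [s]. *)
Lemma pairing_cons (s : V -> V -> bool) (chi : bool * bool)
    (l : seq ((V -> V -> bool) * (bool * bool))) i j :
  {in (s, chi) :: l, forall p, equivar p.1 p.2} ->
  pairing (c i) (c j) (cocycle (map fst ((s, chi) :: l))) =
  (if i is i'.+1 then chi.1 && pairing (c i') (c j) (cocycle (map fst l)) else false)
  (+) (if j is j'.+1 then chi.2 && pairing (c i) (c j') (cocycle (map fst l)) else false).
Proof.
move=> lE /=; set E := cocycle (map fst l).
have sE : equivar s chi by apply: (lE (s, chi)); apply: mem_head.
have E0 f : E [::] f = false /\ E f [::] = false.
  by have [? []] := bdry2_cocycle (map fst l) [::] f;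
    have [? []] := bdry2_cocycle (map fst l) f [::].
have El f g : E (map a f) g = E f g /\ E f (map a g) = E f g :=
  cocycle_map f g (sub_in1 (@mem_behead _ (_ :: l)) lE).
have Wl xs ys : weight s E xs ys (+) weight s E (map a xs) ys = chi.1 && E xs ys.
  rewrite (weight_mapl sE) ?(El _ _).1 // => [|zs|zs]; rewrite ?addKb //;
    first [exact: (E0 _).1 | exact: (E0 _).2].
have Wr xs ys : weight s E xs ys (+) weight s E xs (map a ys) = chi.2 && E xs ys.
  rewrite (weight_mapr sE) ?(El _ _).2 // => [|zs|zs]; rewrite ?addKb //;
    first [exact: (E0 _).1 | exact: (E0 _).2].
rewrite /pairing /bdry2.
under eq_bigr do rewrite big_split.
rewrite big_split; congr (_ (+) _).
  rewrite exchange_big; case: i => [|i].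
    by apply: big1 => ys _; apply: cP.1.
  transitivity (\xor_(ys <- c j) \xor_(xs <- c i) (chi.1 && E xs ys)).
    by apply: eq_bigr => ys _; rewrite cP.2; apply: eq_bigr => xs _; exact: Wl.
  rewrite exchange_big big_distrr; apply: eq_bigr => xs _.
  by rewrite big_distrr.
case: j => [|j].
  by apply: big1 => xs _; apply: cP.1; case: xs.
rewrite big_distrr; apply: eq_bigr => xs _; rewrite cP.2.
by under eq_bigr do rewrite Wr; rewrite big_distrr.
Qed.

End Cochains.

(** * Evaluation of the cocycle on products of hemispheres *)

Section Count.
Variables (V : eqType) (a : V -> V) (c : nat -> seq (seq V)) (e : V).
Hypotheses (cP : sphere_chain a c) (c0 : c 0%N = [:: [:: e]]).
Implicit Type l : seq ((V -> V -> bool) * (bool * bool)).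

Lemma pairing_y l : {in l, forall p, equivar a p.1 p.2} ->
  {in l, forall p, p.2 = (false, true)} ->
  pairing (c 0%N) (c (size l)) (cocycle (map fst l)).
Proof.
elim: l => [|[s chi] l IH] lE l2; first by rewrite /pairing c0 !big_seq1.
have chiE : chi = (false, true) := l2 (s, chi) (mem_head _ _).
rewrite [size _]/= (pairing_cons cP (chi := chi)) // chiE /=.
by apply: IH => p pl; [apply: lE | apply: l2]; rewrite inE pl orbT.
Qed.

(** Each function of [l1] lowers the first dimension by one. Then [t] meets dimension 0 in the first
    factor, so only its second term survives and [pairing_y] finishes. With p and q the lengths of
    [l1] and [l2], this picks the monomial s^p t^(q+1) out of s^p (s + t) t^q. *)
Lemma pairing_xy l1 t l2 : {in l1 ++ t :: l2, forall p, equivar a p.1 p.2} ->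
  {in l1, forall p, p.2 = (true, false)} -> t.2 = (true, true) ->
  {in l2, forall p, p.2 = (false, true)} ->
  pairing (c (size l1)) (c (size l2).+1) (cocycle (map fst (l1 ++ t :: l2))).
Proof.
elim: l1 => [|[s chi] l1 IH] lE h1 ht h2.
  have tE : t = (t.1, (true, true)) by rewrite -ht; case: (t).
  rewrite tE in lE *.
  rewrite cat0s [size [::]]/= (pairing_cons cP (chi := (true, true))) //=.
  by apply: pairing_y => // p pl; apply: lE; rewrite inE pl orbT.
have chiE : chi = (true, false) := h1 (s, chi) (mem_head _ _).
rewrite [size _]/= cat_cons (pairing_cons cP (chi := chi)) // chiE /= addbF.
by apply: IH => // p pl; [apply: lE | apply: h1]; rewrite inE pl orbT.
Qed.

End Count.

(** * Barycentric subdivision *)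

Section Subdivision.
Variables (R : realType) (V : lmodType R).
Notation pt := (V * bool)%type.

(* The bit breaks ties: it lets [sign] below be equivariant where the function
   vanishes. *)
Definition anti (p : pt) : pt := (- p.1, ~~ p.2).

(** The bit is inherited from the first point, which makes the barycentre commute with [anti] on
    nonempty lists; on the empty list the default bit would break this. *)
Definition bary (s : seq pt) : pt :=
  ((size s)%:R^-1 *: \sum_(p <- s) p.1, head false (map snd s)).

Lemma bary_anti x s : bary (map anti (x :: s)) = anti (bary (x :: s)).
Proof.
by rewrite /bary /anti size_map big_map sumrN scalerN.
Qed.

(** The cone from the barycentre over the subdivided faces. [n] is the recursion depth, meant to be
    the size of [s]. *)
Fixpoint sd_rec n (s : seq pt) : seq (seq pt) :=
  if n is n'.+1 then flatten [seq map (cons (bary s)) (sd_rec n' f) | f <- faces s]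
  else [:: [::]].

Definition sd s := sd_rec (size s) s.

Definition sd_sum (F : seq pt -> bool) s := \xor_(t <- sd s) F t.

Lemma sd_sum_rec F s : s != [::] -> sd_sum F s = bdry (sd_sum (fun t => F (bary s :: t))) s.
Proof.
move=> s0; rewrite /sd_sum /sd.
case E: (size s) => [|n]; first by move/size0nil: E s0 => ->.
rewrite /= big_flatten big_map; apply: eq_big_seq => f /faces_sub[_].
by rewrite E => -[->]; rewrite big_map.
Qed.

Lemma sd_sum_nil F : sd_sum F [::] = F [::].
Proof. by rewrite /sd_sum big_seq1. Qed.

(** Dually, subdivision is a chain map. The boundary of a cone is its base plus the cone over the
    boundary of the base; by induction the latter contributes a double boundary, which vanishes. *)
Lemma sd_sum_bdry F s : sd_sum (bdry F) s = bdry (sd_sum F) s.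
Proof.
have [n] := ubnP (size s); elim: n s F => // n IH s F sn.
have [->|s0] := eqVneq s [::]; first by rewrite sd_sum_nil /bdry !big_nil.
rewrite sd_sum_rec //.
transitivity (bdry (fun f => sd_sum F f (+) bdry (sd_sum (fun t => F (bary s :: t))) f) s).
  apply: eq_big_seq => f /faces_sub[_ ef]; rewrite -IH; last by rewrite ef.
  by rewrite /sd_sum -big_split; apply: eq_bigr => t _; rewrite bdry_cons.
by rewrite bdry_add bdry_bdry addbF.
Qed.

Lemma sd_sum_anti F s : sd_sum F (map anti s) = sd_sum (fun t => F (map anti t)) s.
Proof.
have [n] := ubnP (size s); elim: n s F => // n IH s F sn.
have [->|s0] := eqVneq s [::]; first by rewrite !sd_sum_nil.
rewrite !sd_sum_rec //; last by case: s s0 {sn}.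
rewrite bdry_map; apply: eq_big_seq => f /faces_sub[_ ef]; rewrite IH ?ef //.
by case: s s0 {sn ef} => // x s _; rewrite bary_anti.
Qed.

Definition sd_chain (c : seq (seq pt)) := flatten (map sd c).

Lemma sd_chainE c F : \xor_(t <- sd_chain c) F t = \xor_(s <- c) sd_sum F s.
Proof. by rewrite /sd_chain big_flatten big_map. Qed.

Lemma sphere_chain_sd c : sphere_chain anti c -> sphere_chain anti (fun i => sd_chain (c i)).
Proof.
move=> [c0 cS]; split=> [F F0|i F]; rewrite !sd_chainE.
  by under eq_bigr do rewrite sd_sum_bdry; apply: c0; rewrite sd_sum_nil.
under eq_bigr do rewrite sd_sum_bdry.
rewrite cS; apply: eq_bigr => s _.
by rewrite sd_sum_anti /sd_sum -big_split.
Qed.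

Lemma sd_point x : sd [:: x] = [:: [:: x]].
Proof.
by rewrite /sd /= /bary /= big_seq1 invr1 scale1r; case: x.
Qed.

Lemma sd_ind (P : seq pt -> seq pt -> Prop) :
  P [::] [::] ->
  (forall s f t, s != [::] -> f \in faces s -> t \in sd f -> P f t -> P s (bary s :: t)) ->
  forall s t, t \in sd s -> P s t.
Proof.
move=> P0 PS s; have [n] := ubnP (size s); elim: n s => // n IH s sn t.
rewrite /sd; case E: (size s) => [|m] /=.
  by move/size0nil: E => ->; rewrite inE => /eqP->.
move=> /flattenP[r /mapP[f fs ->] /mapP[u]].
have [sub ef] := faces_sub fs; move: ef; rewrite E => -[<-] uf ->.
apply: (PS _ _ _ _ fs uf); first by rewrite -size_eq0 E.
by apply: IH => //; rewrite -ltnS (faces_sub fs).2.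
Qed.

Lemma sd_size s t : t \in sd s -> size t = size s.
Proof.
by move: s t; apply: sd_ind => // s f t _ /faces_sub[_ <-] _ /= ->.
Qed.

(** The form of convexity that subdivision calls for: each new vertex is the mean of a list of old
    ones. *)
Definition mean_closed (C : V -> Prop) := forall s : seq V, s != [::] ->
  {in s, forall x, C x} -> C ((size s)%:R^-1 *: \sum_(x <- s) x).

Lemma sd_closed C s t : mean_closed C -> t \in sd s ->
  {in s, forall p, C p.1} -> {in t, forall p, C p.1}.
Proof.
move=> CP; move: s t; apply: sd_ind => // s f t s0 /faces_sub[sub _] _ IH sC p.
rewrite inE => /predU1P[->|]; last by apply: IH => q /sub; exact: sC.
rewrite /bary /= -(size_map fst) -(big_map fst xpredT id).
apply: CP => [|_ /mapP[q qs ->]]; last exact: sC.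
by rewrite -size_eq0 size_map size_eq0.
Qed.

End Subdivision.

(** * Shrinking of simplices under subdivision *)

Section Mesh.
Variables (R : realType) (V : normedModType R).
Notation pt := (V * bool)%type.
Implicit Types (s t : seq pt).

Lemma mean_dist (s : seq V) c : s != [::] ->
  `|(size s)%:R^-1 *: (\sum_(x <- s) x) - c| <= (size s)%:R^-1 * \sum_(x <- s) `|x - c|.
Proof.
move=> s0; have n0 : (size s)%:R != 0 :> R by rewrite pnatr_eq0 size_eq0.
have -> : (size s)%:R^-1 *: (\sum_(x <- s) x) - c = (size s)%:R^-1 *: \sum_(x <- s) (x - c).
  rewrite sumrB scalerBr; congr (_ - _).
  rewrite big_const_seq count_predT iter_addr_0 -[c *+ _]scaler_nat scalerA mulVf ?scale1r //.
rewrite normrZ ger0_norm ?invr_ge0 ?ler0n //.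
by rewrite ler_wpM2l ?invr_ge0 ?ler0n // ler_norm_sum.
Qed.

Lemma mean_closed_ball (c : V) (r : R) : mean_closed (fun x : V => `|x - c| <= r).
Proof.
move=> s s0 sr; apply: le_trans (mean_dist c s0) _.
have n0 : 0 < (size s)%:R :> R by rewrite ltr0n lt0n size_eq0.
rewrite ler_pdivrMl // mulr_natl -iter_addr_0 -count_predT -big_const_seq.
by rewrite !big_seq; apply: ler_sum.
Qed.

(** In the mean of the differences to [p], the term of [p] itself is zero, which leaves n - 1 terms
    out of n, and (n - 1) / n increases with n. *)
Lemma bary_dist M (D : R) s p : (size s <= M.+1)%N ->
  {in s &, forall p q, `|p.1 - q.1| <= D} -> p \in s ->
  `|p.1 - (bary s).1| <= M%:R / M.+1%:R * D.
Proof.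
move=> sM sD ps.
have s0 : map fst s != [::] by case: s ps {sM sD}.
have D0 : 0 <= D by apply: le_trans (sD p p ps ps).
rewrite distrC /bary /= -(size_map fst) -(big_map fst xpredT id).
apply: le_trans (mean_dist _ s0) _.
rewrite size_map big_map (big_rem p) //= subrr normr0 add0r.
have n0 : (0 < size s)%N by case: s ps {sM sD s0}.
rewrite ler_pdivrMl ?ltr0n //.
apply: (@le_trans _ _ (\sum_(q <- rem p s) D)).
  by rewrite !big_seq; apply: ler_sum => q /mem_rem qs; apply: sD.
rewrite big_const_seq count_predT iter_addr_0 size_rem // -[D *+ _]mulr_natl mulrA.
rewrite ler_wpM2r // mulrA ler_pdivlMr ?ltr0n // -!natrM ler_nat.
by case: (size s) n0 sM => //= n _; rewrite ltnS => nM; rewrite mulnS mulSn leq_add2r.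
Qed.

(** Two vertices of the subdivided face are close by induction. The new barycentre is close to all
    vertices of [s], hence to all means formed from them, since balls are closed under means. *)
Lemma sd_mesh M (D : R) s t : t \in sd s -> (size s <= M.+1)%N ->
  {in s &, forall p q, `|p.1 - q.1| <= D} ->
  {in t &, forall p q, `|p.1 - q.1| <= M%:R / M.+1%:R * D}.
Proof.
move: s t; apply: sd_ind => // s f t s0 fs tf IH sM sD.
have [sub ef] := faces_sub fs.
have {}IH : {in t &, forall p q, `|p.1 - q.1| <= M%:R / M.+1%:R * D}.
  by apply: IH => [|p q /sub ps /sub qs]; [rewrite ltnW // ef | exact: sD].
have B : {in t, forall p, `|p.1 - (bary s).1| <= M%:R / M.+1%:R * D}.
  apply: (sd_closed (C := fun x => `|x - (bary s).1| <= M%:R / M.+1%:R * D) _ tf).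
    exact: mean_closed_ball.
  by move=> p /sub ps; apply: bary_dist.
have D0 : 0 <= M%:R / M.+1%:R * D.
  case: s s0 sD {fs tf sub ef sM B} => // x s _ sD.
  by rewrite mulr_ge0 ?divr_ge0 ?ler0n // (le_trans _ (sD x x _ _)) // mem_head.
move=> p q; rewrite !inE => /predU1P[->|pt] /predU1P[->|qt].
- by rewrite subrr normr0.
- by rewrite distrC; apply: B.
- exact: B.
- exact: IH.
Qed.

(** Each small simplex is traced back to an original simplex [s], from which it inherits the size,
    the mean-closed properties and a geometrically decreasing diameter bound. *)
Lemma iter_sd_chain_mesh M K c t : t \in iter K (@sd_chain R V) c ->
  exists2 s, s \in c & size t = size s /\
   (forall C, mean_closed C -> {in s, forall p, C p.1} -> {in t, forall p, C p.1}) /\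
   ((size s <= M.+1)%N -> forall D, {in s &, forall p q, `|p.1 - q.1| <= D} ->
    {in t &, forall p q, `|p.1 - q.1| <= (M%:R / M.+1%:R) ^+ K * D}).
Proof.
elim: K t => [|K IH] t /=.
  by move=> tc; exists t => //; split=> //; split=> // _ D; rewrite expr0 mul1r.
case/flattenP=> r /mapP[u /IH[s sc [us [Cs Ds]]] ->] tu.
exists s => //; split; first by rewrite (sd_size tu).
split=> [C CP sC|sM D sD]; first exact: sd_closed CP tu (Cs _ CP sC).
rewrite exprS -mulrA; apply: sd_mesh tu _ (Ds sM _ sD); by rewrite us.
Qed.

Lemma sphere_chain_iter K (c : nat -> seq (seq pt)) : sphere_chain (@anti R V) c ->
  sphere_chain (@anti R V) (fun i => iter K (@sd_chain R V) (c i)).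
Proof. by move=> cP; elim: K => //= K; apply: sphere_chain_sd. Qed.

Lemma iter_sd_chain_point K (e : pt) : iter K (@sd_chain R V) [:: [:: e]] = [:: [:: e]].
Proof. by elim: K => //= K ->; rewrite /sd_chain /map sd_point. Qed.

End Mesh.

(** * Hemispheres as iterated cones *)

Section Cone.
Variables (V : eqType) (a : V -> V) (aK : involutive a) (e : nat -> V).

(* For [e i] the basis vectors these are hemispheres of the boundary of the
   cross-polytope. *)
Fixpoint cone_chain i : seq (seq V) :=
  if i is i'.+1 then [seq e i :: s | s <- cone_chain i' ++ map (map a) (cone_chain i')]
  else [:: [:: e 0%N]].

Lemma cone_chainS i : cone_chain i.+1 =
  [seq e i.+1 :: s | s <- cone_chain i ++ map (map a) (cone_chain i)].
Proof. by []. Qed.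

(** The base of each cone is a hemisphere together with its antipode. By induction its boundary is
    an antipodally symmetric chain taken twice, so only the base remains in the boundary of the
    cone. *)
Lemma sphere_chain_cone : sphere_chain a cone_chain.
Proof.
have mapaK : involutive (map a) by move=> s; rewrite mapK.
split=> [G G0|i]; first by rewrite big_seq1 /bdry /= big_seq1.
elim: i => [|i IH] G.
  by rewrite /= !big_cons !big_nil /bdry /= !big_cons !big_nil /= !addbF addbACA addbb addbF.
rewrite (cone_chainS i.+1) big_map; move: IH; set C := cone_chain i.+1 => IH.
transitivity (\xor_(s <- C ++ map (map a) C) (G s (+) bdry (fun f => G (e i.+2 :: f)) s)).
  by apply: eq_bigr => s _; rewrite bdry_cons.
have S2 H : \xor_(s <- C ++ map (map a) C) H s = \xor_(s <- C) (H s (+) H (map a s)).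
  by rewrite big_cat big_map big_split.
rewrite big_split /= !S2.
rewrite -[RHS]addbF; congr (_ (+) _).
move: (fun f => G (e i.+2 :: f)) => H.
have -> : \xor_(s <- C) (bdry H s (+) bdry H (map a s)) =
  \xor_(s <- C) bdry (fun f => H f (+) H (map a f)) s.
  by apply: eq_bigr => s _; rewrite bdry_add bdry_map.
rewrite IH big1 // => s _.
by rewrite mapaK; case: (H s); case: (H _).
Qed.

End Cone.

(** * A two-sphere Borsuk-Ulam theorem *)

Section ColumnNorm.
Variables (R : realType).

Lemma mx_norm_le m n (A : 'M[R]_(m, n)) r : 0 <= r ->
  (forall i j, `|A i j| <= r) -> `|A| <= r.
Proof.
move=> r0 Ar; rewrite [leLHS]/Num.Def.normr /= mx_normrE.
by apply: bigmax_le => // -[i j] _; apply: Ar.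
Qed.

Lemma le_mx_norm m n (A : 'M[R]_(m, n)) i j : `|A i j| <= `|A|.
Proof.
by rewrite [leRHS]/Num.Def.normr /= mx_normrE (le_bigmax _ (fun ij => `|A ij.1 ij.2|) (i, j)).
Qed.

Lemma normr_trmx m n (A : 'M[R]_(m, n)) : `|A^T| = `|A|.
Proof.
have le p q (B : 'M[R]_(p, q)) : `|B^T| <= `|B|.
  by apply: mx_norm_le => // i j; rewrite mxE le_mx_norm.
by apply/eqP; rewrite eq_le le -{1}[A]trmxK le.
Qed.

Lemma continuous_trmx m n : continuous (@trmx R m n).
Proof.
move=> A U [P hP PU]; exists (fun i j => P j i) => [i j|B hB].
  by have := hP j i; rewrite mxE.
by apply: PU => i j; rewrite mxE; apply: hB.
Qed.

Lemma cV_bounded_closed_compact n (A : set 'cV[R]_n) :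
  bounded_set A -> closed A -> compact A.
Proof.
move=> [M [Mr AM]] Acl.
have -> : A = trmx @` (trmx @^-1` A : set 'rV[R]_n).
  apply/seteqP; split=> [x Ax|_ [y Ay <-]//].
  by exists x^T; rewrite ?trmxK //= trmxK.
apply: continuous_compact; first exact/continuous_subspaceT/continuous_trmx.
apply: bounded_closed_compact.
  by exists M; split=> // r Mr' x /(AM r Mr') /=; rewrite normr_trmx.
by apply: (continuous_closedP _).1 => //; exact: continuous_trmx.
Qed.

Lemma dot_le d (x y : 'cV[R]_d) (r s : R) : 0 <= r -> (forall i, `|x i 0| <= r) ->
  `|y| <= s -> `|dot x y| <= d%:R * (r * s).
Proof.
move=> r0 xr ys; apply: le_trans (ler_norm_sum _ _ _) _.
apply: (@le_trans _ _ (\sum_(i < d) r * s)).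
  apply: ler_sum => i _; rewrite normrM ler_pM //.
  exact: le_trans (le_mx_norm _ _ _) ys.
by rewrite sumr_const card_ord mulr_natl.
Qed.

Lemma dotC d (x y : 'cV[R]_d) : dot x y = dot y x.
Proof. by apply: eq_bigr => i _; rewrite mulrC. Qed.
Lemma dotDl d (x y z : 'cV[R]_d) : dot (x + y) z = dot x z + dot y z.
Proof. by rewrite -big_split; apply: eq_bigr => i _; rewrite mxE mulrDl. Qed.
Lemma dotZl d a (x z : 'cV[R]_d) : dot (a *: x) z = a * dot x z.
Proof. by rewrite /dot mulr_sumr; apply: eq_bigr => i _; rewrite mxE mulrA. Qed.
Lemma dotDr d (x y z : 'cV[R]_d) : dot z (x + y) = dot z x + dot z y.
Proof. by rewrite dotC dotDl !(dotC z). Qed.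
Lemma dotZr d a (x z : 'cV[R]_d) : dot z (a *: x) = a * dot z x.
Proof. by rewrite dotC dotZl dotC. Qed.
Lemma dotNl d (x z : 'cV[R]_d) : dot (- x) z = - dot x z.
Proof. by rewrite -scaleN1r dotZl mulN1r. Qed.
Lemma dotNr d (x z : 'cV[R]_d) : dot z (- x) = - dot z x.
Proof. by rewrite dotC dotNl dotC. Qed.
Lemma dotBl d (x y z : 'cV[R]_d) : dot (x - y) z = dot x z - dot y z.
Proof. by rewrite dotDl dotNl. Qed.
Lemma dotBr d (x y z : 'cV[R]_d) : dot z (x - y) = dot z x - dot z y.
Proof. by rewrite dotDr dotNr. Qed.
Lemma dot0l d (z : 'cV[R]_d) : dot 0 z = 0.
Proof. by rewrite -(scale0r z) dotZl mul0r. Qed.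
Lemma dot0r d (z : 'cV[R]_d) : dot z 0 = 0.
Proof. by rewrite dotC dot0l. Qed.
Lemma dot_sumr d I (r : seq I) (F : I -> 'cV[R]_d) z :
  dot z (\sum_(i <- r) F i) = \sum_(i <- r) dot z (F i).
Proof. by elim/big_ind2: _ => [|? ? ? ? <- <-|//]; rewrite ?dot0r ?dotDr. Qed.

End ColumnNorm.

(** * Common zeros of functions with prescribed parities *)

Section Cross.
Variables (R : realType) (d : nat).
Notation V := 'cV[R]_d.

Definition cross_vertex (i : nat) : V * bool := (\col_(l < d) (l == i :> nat)%:R, true).

Lemma antiK : involutive (@anti R V).
Proof. by case=> x b; rewrite /anti opprK negbK. Qed.

(* The functional [w] is 1 on the whole simplex, which keeps the points of its
   subdivisions away from 0. *)
Lemma cross_chain i s : (i < d)%N -> s \in cone_chain (@anti R V) cross_vertex i ->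
  size s = i.+1 /\ exists w : V, [/\ (forall l, `|w l 0| <= 1),
    (forall l : 'I_d, (i < l)%N -> w l 0 = 0) & {in s, forall p, [/\ dot w p.1 = 1,
      `|p.1| <= 1 & forall l : 'I_d, (i < l)%N -> p.1 l 0 = 0]}].
Proof.
have cn j : `|(cross_vertex j).1| <= 1.
  by apply: mx_norm_le => // l k; rewrite mxE; case: (_ == _); rewrite ?normr1 ?normr0.
have c0 j (l : 'I_d) : (j < l)%N -> (cross_vertex j).1 l 0 = 0.
  by move=> jl; rewrite mxE gtn_eqF.
have cd j (x : V) (jd : (j < d)%N) : dot (cross_vertex j).1 x = x (Ordinal jd) 0.
  rewrite /dot (bigD1 (Ordinal jd)) //= mxE eqxx mul1r big1 ?addr0 // => l lj.
  by rewrite mxE; rewrite -val_eqE /= in lj; rewrite (negPf lj) mul0r.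
elim: i s => [|i IH] s id.
  rewrite inE => /eqP->; split=> //; exists (cross_vertex 0).1; split=> //.
  - by move=> l; apply: le_trans (le_mx_norm _ _ _) (cn 0%N).
  - exact: c0.
  - move=> p; rewrite inE => /eqP->; split=> //; first by rewrite cd mxE eqxx.
    exact: c0.
rewrite cone_chainS => /mapP[t + ->].
have {IH} : forall t, t \in cone_chain (@anti R V) cross_vertex i ++
    map (map (@anti R V)) (cone_chain (@anti R V) cross_vertex i) -> size t = i.+1 /\
  exists w : V, [/\ (forall l, `|w l 0| <= 1),
    (forall l : 'I_d, (i < l)%N -> w l 0 = 0) & {in t, forall p, [/\ dot w p.1 = 1,
      `|p.1| <= 1 & forall l : 'I_d, (i < l)%N -> p.1 l 0 = 0]}].
  move=> v; rewrite mem_cat => /orP[|/mapP[u + ->]]; first by move/(IH _ (ltnW id)).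
  move=> /(IH _ (ltnW id)) [ts [w [w1 w2 w3]]]; split; first by rewrite size_map.
  exists (- w); split=> [l|l il|_ /mapP[p pt ->]].
  - by rewrite mxE normrN.
  - by rewrite mxE w2 // oppr0.
  - have [p1 p2 p3] := w3 p pt; rewrite /= dotNl dotNr opprK normrN; split=> // l il.
    by rewrite mxE p3 // oppr0.
move=> IH /IH[ts [w [w1 w2 w3]]]; split; first by rewrite /= ts.
exists (w + (cross_vertex i.+1).1); split=> [l|l il|p].
- rewrite mxE; have [il|li] := ltnP i l.
    by rewrite w2 // add0r (le_trans (le_mx_norm _ _ _) (cn _)).
  by rewrite [X in _ + X]mxE ltn_eqF ?addr0 // ltnS.
- by rewrite mxE w2 ?c0 ?addr0 // ltnW.
- rewrite inE => /predU1P[->|pt].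
    rewrite dotDl; split=> //; last exact: c0.
    by rewrite dotC !(cd _ _ id) mxE eqxx w2 ?add0r.
  have [p1 p2 p3] := w3 p pt; split=> // [|l il]; last by rewrite p3 // ltnW.
  by rewrite dotDl p1 cd p3 ?addr0.
Qed.

Lemma mean_closed_dot (w : V) : mean_closed (fun x : V => dot w x = 1).
Proof.
move=> s s0 sw; rewrite dotZr dot_sumr big_seq (eq_bigr (fun=> 1)) // -big_seq.
by rewrite big_const_seq count_predT iter_addr_0 mulVf // pnatr_eq0 size_eq0.
Qed.

Lemma big_xor_true (T : eqType) (r : seq T) (F : T -> bool) :
  \xor_(i <- r) F i -> exists2 i, i \in r & F i.
Proof.
elim: r => [|x r IH]; first by rewrite big_nil.
rewrite big_cons.
case Fx: (F x); first by exists x; rewrite ?mem_head.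
rewrite addFb => /IH[i ir Fi].
by exists i; rewrite // inE ir orbT.
Qed.

Definition parity (f : V -> V -> R) (chi : bool * bool) :=
  (forall x y, f (- x) y = (-1) ^+ chi.1 * f x y) /\
  (forall x y, f x (- y) = (-1) ^+ chi.2 * f x y).

(** At a zero of [f] the bits decide, so that [anti] acts through [chi] there too. The tie value is
    harmless: [true] still implies [0 <= f] and [false] implies [f <= 0]. *)
Definition sign (f : V -> V -> R) (chi : bool * bool) (p q : V * bool) : bool :=
  if f p.1 q.1 == 0 then (chi.1 && p.2) (+) (chi.2 && q.2) else 0 < f p.1 q.1.

Lemma equivar_sign f chi : parity f chi -> equivar (@anti R V) (sign f chi) chi.
Proof.
case: chi => c1 c2 [/= f1 f2]; split=> -[x b] [y c]; rewrite /sign /= ?f1 ?f2.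
  case: c1 f1 => f1; rewrite ?expr1 ?expr0 ?mul1r ?addbF // mulN1r oppr_eq0 oppr_gt0.
  by case: ltrgtP => // _; case: b; case: (c2); case: c.
case: c2 f2 => f2; rewrite ?expr1 ?expr0 ?mul1r ?addbF // mulN1r oppr_eq0 oppr_gt0.
by case: ltrgtP => // _; case: b; case: (c1); case: c.
Qed.

(** The factor 2 bounds the distance between two points of sup norm at most 1, hence the simplices
    before subdivision. *)
Lemma geometric_small M (e : R) : 0 < e ->
  exists K, (M%:R / M.+1%:R) ^+ K * 2 < e.
Proof.
move=> e0; have z1 : `|M%:R / M.+1%:R : R| < 1.
  by rewrite ger0_norm ?divr_ge0 // ltr_pdivrMr ?ltr0n // mul1r ltr_nat.
have /cvgrPdist_lt /(_ (e / 2)) := cvg_expr z1.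
rewrite divr_gt0 // => /(_ isT) [K _ /(_ K (leqnn _))].
rewrite /= sub0r normrN normrX (ger0_norm (divr_ge0 _ _)) // => lt.
by exists K; rewrite -ltr_pdivlMr.
Qed.

(* A compact set containing the cross-polytope boundary and avoiding 0 (if
   [0 < d]); zeros are normalised later. *)
Definition shell : set V := [set x | `|x| <= 1 /\ d%:R^-1 <= `|x|].

Lemma compact_shell : compact shell.
Proof.
apply: cV_bounded_closed_compact.
  by exists 1; split=> [|r r1 x [x1 _]]; [exact: num_real | exact: le_trans x1 (ltW r1)].
have -> : shell = (@Num.Def.normr R V) @^-1` [set r | r <= 1] `&`
  (@Num.Def.normr R V) @^-1` [set r | d%:R^-1 <= r] by [].
apply: closedI; apply: (continuous_closedP _).1; try exact: norm_continuous.
  exact: closed_le.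
exact: closed_ge.
Qed.

Lemma dot_shell (w x : V) : (0 < d)%N -> (forall l, `|w l 0| <= 1) -> dot w x = 1 ->
  d%:R^-1 <= `|x|.
Proof.
move=> d0 w1 wx; have := dot_le ler01 w1 (lexx `|x|).
by rewrite wx normr1 mul1r -ler_pdivrMl ?ltr0n // mulr1.
Qed.

Variables (l1 l2 : seq ((V -> V -> R) * (bool * bool))) (t : (V -> V -> R) * (bool * bool)).
Let l := l1 ++ t :: l2.
Hypotheses (l1d : (size l1 < d)%N) (l2d : ((size l2).+1 < d)%N).
Hypothesis lP : {in l, forall f, parity f.1 f.2}.
Hypothesis l1P : {in l1, forall f, f.2 = (true, false)}.
Hypothesis l2P : {in l2, forall f, f.2 = (false, true)}.
Hypothesis tP : t.2 = (true, true).

(** The pairing with finely subdivided hemispheres is odd, so the cocycle is nonzero on some cell.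
    By [cocycle_varies] every sign takes both values on this one small cell. *)
Lemma approximate_zero (e : R) : 0 < e -> exists x0 y0, [/\ shell x0, shell y0 &
  {in l, forall f, exists x y x' y',
    [/\ `|x - x0| < e, `|y - y0| < e, `|x' - x0| < e & `|y' - y0| < e] /\
    0 <= f.1 x y /\ f.1 x' y' <= 0}].
Proof.
move=> e0; have [K Ke] := geometric_small d e0.
pose c i := iter K (@sd_chain R V) (cone_chain (@anti R V) cross_vertex i).
have cP : sphere_chain (@anti R V) c.
  exact/sphere_chain_iter/sphere_chain_cone/antiK.
have c0 : c 0%N = [:: [:: cross_vertex 0]] by rewrite /c iter_sd_chain_point.
have d0 : (0 < d)%N by apply: leq_ltn_trans l1d.
pose sg (f : (V -> V -> R) * (bool * bool)) := (sign f.1 f.2, f.2).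
have : pairing (c (size l1)) (c (size l2).+1) (cocycle (map fst (map sg l))).
  have := @pairing_xy _ _ _ _ cP c0 (map sg l1) (sg t) (map sg l2).
  rewrite !size_map -map_cons -map_cat; apply => //.
  - by move=> _ /mapP[f fl ->]; apply/equivar_sign/lP.
  - by move=> _ /mapP[f fl ->]; apply: l1P.
  - by move=> _ /mapP[f fl ->]; apply: l2P.
move=> /big_xor_true[s sc /big_xor_true[u uc lsu]].
have cC i s' : (i < d)%N -> s' \in c i -> {in s', forall p, shell p.1} /\
    {in s' &, forall p q, `|p.1 - q.1| < e}.
  move=> id /(iter_sd_chain_mesh d)[s0 s0c [es [sC sM]]].
  have [s0s [w [w1 _ w3]]] := cross_chain id s0c.
  split=> [p ps|p q ps qs].
    split; last first.
      apply: dot_shell w1 _ => //.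
      by apply: (sC (fun x => dot w x = 1)) ps => [|q /w3[]//]; exact: mean_closed_dot.
    rewrite -[p.1]subr0.
    apply: (sC (fun x => `|x - 0| <= 1)) ps => [|q /w3[]]; first exact: mean_closed_ball.
    by rewrite subr0.
  apply: le_lt_trans Ke; apply: sM => //.
    by rewrite s0s ltnW.
  move=> p' q' /w3[_ p1 _] /w3[_ q1 _].
  by rewrite (le_trans (ler_normB _ _)) // (le_trans (lerD p1 q1)) // -natr1.
have [s1 s2] := cC _ _ l1d sc.
have [u1 u2] := cC _ _ l2d uc.
have lsu' f : f \in l -> exists p q, [/\ p.1 \in s, p.2 \in u, q.1 \in s, q.2 \in u &
    (sg f).1 p.1 p.2 && ~~ (sg f).1 q.1 q.2].
  by move=> fl; apply: cocycle_varies lsu; apply/map_f/map_f.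
(* The sign change of [t] is used here only to obtain a point of the cell, which serves as the
   centre. *)
have [p [_ [ps pu _ _ _]]] : exists p q, [/\ p.1 \in s, p.2 \in u, q.1 \in s, q.2 \in u &
    (sg t).1 p.1 p.2 && ~~ (sg t).1 q.1 q.2].
  by apply: lsu'; rewrite mem_cat mem_head orbT.
exists p.1.1, p.2.1; split; [exact: s1|exact: u1|].
move=> f /lsu'[q [q' [qs qu qs' qu']]] /andP[fq fq'].
exists q.1.1, q.2.1, q'.1.1, q'.2.1; split; first by split; first [exact: s2 | exact: u2].
move: fq fq'; rewrite /sg /sign /=; split.
  by move: fq; case: ltrgtP.
by move: fq'; case: ltrgtP.
Qed.

Definition jointly_continuous (f : V -> V -> R) := continuous (fun z : V * V => f z.1 z.2).

Hypothesis lC : {in l, forall f, jointly_continuous f.1}.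

Theorem common_zero : exists x y, [/\ shell x, shell y &
  {in l, forall f, f.1 x y = 0}].
Proof.
have /choice[z zP] n : exists z : V * V, [/\ shell z.1, shell z.2 &
  {in l, forall f, exists x y x' y',
    [/\ `|x - z.1| < n.+1%:R^-1, `|y - z.2| < n.+1%:R^-1,
        `|x' - z.1| < n.+1%:R^-1 & `|y' - z.2| < n.+1%:R^-1] /\
    0 <= f.1 x y /\ f.1 x' y' <= 0}].
  have [|x0 [y0 h]] := @approximate_zero n.+1%:R^-1; first by rewrite invr_gt0 ltr0n.
  by exists (x0, y0).
have [] := @compact_setX _ _ _ _ compact_shell compact_shell (z @ \oo) _.
  by exists 0%N => // n _; have [] := zP n.
move=> [x y] [[sx sy] clz]; exists x, y; split=> // f fl.
(* A neighbourhood of the cluster point contains the whole product of balls around some [z n]. A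
   strict sign of [f.1] near [(x, y)] would then contradict the sign change that comes with
   [z n]. *)
have near_z (U : set (V * V)) : nbhs (x, y) U -> exists n, forall x' y',
    `|x' - (z n).1| < n.+1%:R^-1 -> `|y' - (z n).2| < n.+1%:R^-1 -> U (x', y').
  move=> /nbhs_ballP[r r0 rU].
  have [N _ HN] : \forall n \near \oo, n.+1%:R^-1 < r / 2.
    have r2 : 0 < r / 2 by rewrite divr_gt0.
    exact: near_infty_natSinv_lt (PosNum r2).
  have b1 : (z @ \oo) [set z n | n in [set n | (N <= n)%N]].
    by exists N => // n Nn /=; exists n.
  have b2 : nbhs (x, y) (ball (x, y) (r / 2)) by apply: nbhsx_ballx; rewrite divr_gt0.
  have [_ [[n Nn <-]]] := clz _ _ b1 b2.
  rewrite /ball /= /prod_ball /= -!ball_normE /= => -[bx by_].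
  have nr := HN n Nn; exists n => x' y' xn yn; apply: rU.
  rewrite /ball /= /prod_ball /= -!ball_normE /=; split.
    rewrite (splitr r) (le_lt_trans (ler_distD (z n).1 _ _)) // ltrD //.
    by rewrite distrC (lt_trans xn).
  rewrite (splitr r) (le_lt_trans (ler_distD (z n).2 _ _)) // ltrD //.
  by rewrite distrC (lt_trans yn).
have /(_ (x, y)) fC := lC fl.
have [f0|f0|//] := ltrgtP (f.1 x y) 0.
  have [n nP] : exists n, forall x' y', `|x' - (z n).1| < n.+1%:R^-1 ->
      `|y' - (z n).2| < n.+1%:R^-1 -> f.1 x' y' < 0.
    by apply: (near_z [set p | f.1 p.1 p.2 < 0]); apply: (fC [set r | r < 0]);
      apply: open_nbhs_nbhs; split; [exact: open_lt|].
  have [_ _ /(_ f fl)[x1 [y1 [x2 [y2 [[x1z y1z _ _] [f1 _]]]]]]] := zP n.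
  by move: f1; rewrite leNgt nP.
have [n nP] : exists n, forall x' y', `|x' - (z n).1| < n.+1%:R^-1 ->
    `|y' - (z n).2| < n.+1%:R^-1 -> 0 < f.1 x' y'.
  by apply: (near_z [set p | 0 < f.1 p.1 p.2]); apply: (fC [set r | 0 < r]);
    apply: open_nbhs_nbhs; split; [exact: open_gt|].
have [_ _ /(_ f fl)[x1 [y1 [x2 [y2 [[_ _ x2z y2z] [_ f2]]]]]]] := zP n.
by move: f2; rewrite leNgt nP.
Qed.

End Cross.

(** * The support function *)

Section Euclid.
Variables (R : realType) (d : nat).
Notation V := 'cV[R]_d.
Implicit Types (x y u v : V) (X : set V).

Lemma dot_ge0 x : 0 <= dot x x.
Proof. by apply: sumr_ge0 => i _; rewrite -expr2 sqr_ge0. Qed.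

Lemma sqr_enorm x : enorm x ^+ 2 = dot x x.
Proof. by rewrite /enorm sqr_sqrtr ?dot_ge0. Qed.

Lemma enorm_ge0 x : 0 <= enorm x.
Proof. exact: sqrtr_ge0. Qed.

Lemma dot_eq0 x : dot x x = 0 -> x = 0.
Proof.
move=> /eqP; rewrite psumr_eq0 => [/allP x0|i _]; last by rewrite -expr2 sqr_ge0.
apply/matrixP => i j; rewrite (ord1 j) mxE; apply/eqP.
by have := x0 i (mem_index_enum _); rewrite /= mulf_eq0 orbb.
Qed.

Lemma enorm_gt0 x : x != 0 -> 0 < enorm x.
Proof.
move=> x0; rewrite lt_neqAle enorm_ge0 andbT eq_sym; apply: contraNneq x0 => e0.
by apply/eqP/dot_eq0; rewrite -sqr_enorm e0 expr0n.
Qed.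

Lemma enormN x : enorm (- x) = enorm x.
Proof. by rewrite /enorm dotNl dotNr opprK. Qed.

Lemma cauchy_schwarz x y : dot x y <= enorm x * enorm y.
Proof.
have [->|x0] := eqVneq x 0; first by rewrite dot0l mulr_ge0 ?enorm_ge0.
have [->|y0] := eqVneq y 0; first by rewrite dot0r mulr_ge0 ?enorm_ge0.
have := dot_ge0 (enorm y *: x - enorm x *: y).
rewrite !(dotBl, dotBr, dotZl, dotZr) -!sqr_enorm (dotC y x).
have px := enorm_gt0 x0; have py := enorm_gt0 y0.
have pp : 0 < enorm x * enorm y by rewrite mulr_gt0.
have -> : enorm y * (enorm y * enorm x ^+ 2 - enorm x * dot x y) -
  enorm x * (enorm y * dot x y - enorm x * enorm y ^+ 2) =
  2 * (enorm x * enorm y) * (enorm x * enorm y - dot x y) by ring.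
by rewrite pmulr_rge0 ?subr_ge0 // mulr_gt0.
Qed.

Lemma enorm_le x : enorm x <= Num.sqrt d%:R * `|x|.
Proof.
have := dot_le (normr_ge0 x) (fun i => le_mx_norm x i 0) (lexx `|x|).
rewrite ger0_norm ?dot_ge0 // -expr2 => le.
by rewrite /enorm (le_trans (ler_wsqrtr le)) // sqrtrM ?ler0n // sqrtr_sqr normr_id.
Qed.

Lemma lipschitz_continuous (f : V -> R) (C : R) :
  (forall u v, `|f u - f v| <= C * `|u - v|) -> continuous f.
Proof.
move=> fC u U /nbhs_ballP[e /= e0 eU]; apply/nbhs_ballP.
have C0 : 0 < `|C| + 1 by rewrite ltr_wpDl.
exists (e / (`|C| + 1)); first by rewrite /= divr_gt0.
move=> v; rewrite -ball_normE /= => uv; apply: eU; rewrite /ball /=.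
apply: le_lt_trans (fC u v) _; apply: (@le_lt_trans _ _ ((`|C| + 1) * `|u - v|)).
  by rewrite ler_wpM2r // (le_trans (ler_norm C)) // lerDl.
by rewrite -ltr_pdivlMl // mulrC.
Qed.

Lemma center_function X : diam X = 1%:E ->
  exists g : V -> R, [/\ forall u, g (- u) = - g u,
    forall c u, 0 < c -> g (c *: u) = c * g u, continuous g &
    forall x u, X x -> `|dot x u - g u| <= 2^-1 * enorm u].
Proof.
move=> dX.
have X1 x y : X x -> X y -> enorm (x - y) <= 1.
  move=> Xx Xy; rewrite -lee_fin -dX; apply: ereal_sup_ubound.
  by exists x => //; exists y.
(* The empty set has [diam] equal to -oo, not 1. *)
have [x0 Xx0] : X !=set0.
  apply/set0P; apply/eqP => X0; move: dX; rewrite /diam X0.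
  have -> : [set (enorm (x - y))%:E | x in (set0 : set V) & y in (set0 : set V)] = set0.
    by apply/seteqP; split=> // z [].
  by rewrite ereal_sup0.
have Xd x y u : X x -> X y -> dot x u <= dot y u + enorm u.
  move=> Xx Xy; rewrite -lerBlDl -dotBl (le_trans (cauchy_schwarz _ _)) //.
  by rewrite -[leRHS]mul1r ler_wpM2r ?enorm_ge0 // X1.
pose h u := sup [set dot x u | x in X].
have hs u : has_sup [set dot x u | x in X].
  split; first by exists (dot x0 u), x0.
  by exists (dot x0 u + enorm u) => _ [x Xx <-]; apply: Xd.
have h_ub x u : X x -> dot x u <= h u.
  by move=> Xx; apply: sup_upper_bound => //; exists x.
have h_le u M : (forall x, X x -> dot x u <= M) -> h u <= M.
  move=> uM; apply: ge_sup; first by exists (dot x0 u), x0.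
  by move=> _ [x Xx <-]; apply: uM.
have hZle c u : 0 < c -> h (c *: u) <= c * h u.
  by move=> c0; apply: h_le => x Xx; rewrite dotZr ler_pM2l // h_ub.
have hZ c u : 0 < c -> h (c *: u) = c * h u.
  move=> c0; apply/eqP; rewrite eq_le hZle //=.
  have := hZle c^-1 (c *: u); rewrite scalerA mulVf ?gt_eqF // scale1r invr_gt0 => /(_ c0).
  by rewrite ler_pdivlMl.
(* Comparison with the fixed point [x0] bounds [dot x (u - v)] uniformly over [X], which makes [h]
   Lipschitz. *)
have hL u v : h u <= h v + (d%:R * `|x0| + Num.sqrt d%:R) * `|u - v|.
  apply: h_le => x Xx; rewrite -[in dot x u](subrK v u) dotDr addrC lerD ?h_ub //.
  rewrite mulrDl (le_trans (Xd x x0 _ Xx Xx0)) // lerD ?enorm_le // -mulrA.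
  by rewrite (le_trans (ler_norm _)) // (dot_le (normr_ge0 _)) // => i; apply: le_mx_norm.
(* The left side is the width of [X] in direction [u], scaled by the length of [u]. This bound gives
   the strip centred at [g u] its half-width. *)
have hP u : h u + h (- u) <= enorm u.
  rewrite -lerBrDr; apply: (h_le u) => x Xx; rewrite lerBrDr addrC -lerBrDr.
  by apply: (h_le (- u)) => y Xy; rewrite dotNr; have := Xd x y u Xx Xy; lra.
exists (fun u => (h u - h (- u)) / 2); split.
- by move=> u; rewrite opprK; ring.
- by move=> c u c0; rewrite -scalerN !hZ //; ring.
- apply: (@lipschitz_continuous _ (d%:R * `|x0| + Num.sqrt d%:R)) => u v.
  have e1 : `|v - u| = `|u - v| by rewrite distrC.
  have e2 : `|- v - - u| = `|u - v| by rewrite opprK addrC.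
  have e3 : `|- u - - v| = `|u - v| by rewrite opprK addrC e1.
  have := hL u v; have := hL v u; have := hL (- u) (- v); have := hL (- v) (- u).
  by rewrite e1 e2 e3 ler_norml; lra.
- move=> x u Xx; have := hP u; have := h_ub x u Xx; have := h_ub x (- u) Xx.
  by rewrite dotNr ler_norml; lra.
Qed.

End Euclid.

(** * The polygons *)

Section Polygon.
Variables (R : realType).
Notation V := 'cV[R]_2.

Lemma eq_col2 (x y : V) : x 0 0 = y 0 0 -> x 1 0 = y 1 0 -> x = y.
Proof.
move=> e0 e1; apply/matrixP => i j; rewrite (ord1 j).
by have [->|->] : i = 0 \/ i = 1 by case: i => -[|[|//]] p; [left|right]; apply: val_inj.
Qed.

Lemma reflection0 (x : V) : reflection x 0 0 = x 0 0.
Proof. by rewrite mxE expr0 mul1r. Qed.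

Lemma reflection1 (x : V) : reflection x 1 0 = - x 1 0.
Proof. by rewrite mxE expr1 mulN1r. Qed.

Lemma reflectionK : involutive (@reflection R).
Proof. by move=> x; apply: eq_col2; rewrite ?reflection0 ?reflection1 ?opprK. Qed.

Lemma reflection_linear (t u : R) x y :
  reflection (t *: x + u *: y) = t *: reflection x + u *: reflection y.
Proof. by apply/matrixP => i j; rewrite !mxE; ring. Qed.

Lemma vertices_image (P : set V) (f : V -> V) :
  involutive f -> (forall t u x y, f (t *: x + u *: y) = t *: f x + u *: f y) ->
  (forall x, P x -> P (f x)) -> forall x, vertices P x -> vertices P (f x).
Proof.
move=> fK fl fP x [Px xe]; split; first exact: fP.
move=> y z t Py Pz t01 fx.
have xE : x = t *: f y + (1 - t) *: f z by rewrite -fl -fx fK.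
have [yx zx] := xe _ _ t (fP _ Py) (fP _ Pz) t01 xE.
by split; [rewrite -yx | rewrite -zx]; rewrite fK.
Qed.

Lemma count_involution (T : eqType) (s : seq T) (f : T -> T) (p q : pred T) :
  uniq s -> involutive f -> {in s, forall x, f x \in s} ->
  {in s, forall x, p (f x) = q x} -> count p s = count q s.
Proof.
move=> us fK fs pq.
have : perm_eq (map f s) s.
  apply: uniq_perm => //; first by rewrite map_inj_uniq //; exact: inv_inj.
  move=> x; apply/mapP/idP => [[y ys ->]|xs]; first exact: fs.
  by exists (f x); rewrite ?fs ?fK.
move/permP => <-; rewrite count_map; exact: eq_in_count.
Qed.

Lemma unit_vector2 (x : V) : enorm x = 1 -> x 0 0 ^+ 2 + x 1 0 ^+ 2 = 1.
Proof.
move=> x1; have := sqr_enorm x; rewrite x1 expr1n => ->.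
by rewrite /dot !big_ord_recl big_ord0 addr0 -!expr2; congr (_ + x _ 0 ^+ 2); apply: val_inj.
Qed.

(** [u] lists the vertices in the open first quadrant. Central symmetry and the reflection carry
    them to the other three quadrants, so counting vertices leaves only [(1, 0)] and [(-1, 0)] on
    the axes. *)
Lemma inscribed_symmetric_polygon_quadrant (m : nat) (P : set V) :
  inscribed_symmetric_polygon (4 * m + 2) P ->
  exists u : seq (R * R), [/\ size u = m, {in u, forall p, p.2 != 0} &
    forall x, vertices P x -> x = delta_mx 0 0 \/ x = - delta_mx 0 0 \/
      exists2 p, p \in u & exists e1 e2 : bool,
        x 0 0 = (-1) ^+ e1 * p.1 /\ x 1 0 = (-1) ^+ e2 * p.2].
Proof.
move=> [_ [cP [nP [P1 [PN PR]]]]].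
have fP : finite_set (vertices P) by apply/finite_setP; exists (4 * m + 2)%N.
pose s : seq V := fset_set (vertices P).
have us : uniq s by exact: fset_uniq.
have ss : size s = (4 * m + 2)%N by exact: card_fset_set.
have sP x : x \in s <-> vertices P x by rewrite in_fset_set // inE.
have sN : {in s, forall x, - x \in s}.
  move=> x /sP xs; apply/sP; apply: vertices_image xs => //; first exact: opprK.
  by move=> t u y z; rewrite opprD !scalerN.
have sR : {in s, forall x, reflection x \in s}.
  move=> x /sP xs; apply/sP; apply: vertices_image xs => //; first exact: reflectionK.
  exact: reflection_linear.
(* The seven predicates partition the plane into the open quadrants, the two open halves of the
   second axis, and the first axis. *)
pose pp (x : V) := (0 < x 0 0) && (0 < x 1 0).
pose nn (x : V) := (x 0 0 < 0) && (x 1 0 < 0).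
pose pn (x : V) := (0 < x 0 0) && (x 1 0 < 0).
pose np (x : V) := (x 0 0 < 0) && (0 < x 1 0).
pose zp (x : V) := (x 0 0 == 0) && (0 < x 1 0).
pose zn (x : V) := (x 0 0 == 0) && (x 1 0 < 0).
pose ay (x : V) := x 1 0 == 0.
have tot : size s = (count pp s + count nn s + count pn s + count np s + count zp s + count zn s
   + count ay s)%N.
  have one x : (pp x + nn x + pn x + np x + zp x + zn x + ay x = 1)%N.
    rewrite /pp /nn /pn /np /zp /zn /ay.
    by case: (ltrgtP (x 0 0)) => _; case: (ltrgtP (x 1 0)) => _.
  by elim: (s) => //= x r ->; have := one x; lia.
have ax (x : V) : x \in s -> x 1 0 = 0 -> x = delta_mx 0 0 \/ x = - delta_mx 0 0.
  move=> /sP/nP/unit_vector2 + x1; rewrite x1 expr0n addr0 => /eqP.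
  by rewrite sqrf_eq1 => /orP[]/eqP x0; [left|right]; apply: eq_col2;
    rewrite !mxE ?x0 ?x1 /= ?oppr0.
have c1 : count ay s = 2%N.
  have ne : (delta_mx 0 0 : V) != - delta_mx 0 0.
    by apply/eqP => /matrixP/(_ 0 0); rewrite !mxE /= => /eqP; rewrite -addr_eq0 -natrD pnatr_eq0.
  have -> : count ay s = count (predU (pred1 (delta_mx 0 0)) (pred1 (- delta_mx 0 0))) s.
    apply: eq_in_count => x xs; rewrite /= /ay; apply/eqP/orP => [/(ax x xs)[->|->]|].
    - by left.
    - by right.
    - by case=> /eqP->; rewrite !mxE ?oppr0.
  have := count_predUI (pred1 (delta_mx 0 0)) (pred1 (- delta_mx 0 0)) s.
  rewrite !count_uniq_mem // sN ?(proj2 (sP _)) //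
    (@eq_count _ (predI _ _) pred0) ?count_pred0 ?addn0 //.
  by move=> x /=; apply/negbTE; apply: contra ne => /andP[/eqP<-].
have cnn : count nn s = count pp s.
  by apply: (count_involution us (@opprK _) sN) => x _; rewrite /nn /pp !mxE !oppr_lt0.
have cpn : count pn s = count pp s.
  by apply: (count_involution us reflectionK sR) => x _;
     rewrite /pn /pp reflection0 reflection1 oppr_lt0.
have cnp : count np s = count pn s.
  by apply: (count_involution us (@opprK _) sN) => x _; rewrite /np /pn !mxE oppr_lt0 oppr_gt0.
have czn : count zn s = count zp s.
  by apply: (count_involution us (@opprK _) sN) => x _; rewrite /zn /zp !mxE oppr_lt0 oppr_eq0.
(* The vector [\col_i i] is (0, 1), the only unit vector on the positive half of the second axis. *)
have czp : (count zp s <= 1)%N.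
  apply: (@leq_trans (count_mem (\col_i (i : nat)%:R : V) s)); last first.
    by rewrite count_uniq_mem // leq_b1.
  have -> : count zp s = count (predI zp (pred1 (\col_i (i : nat)%:R : V))) s.
    apply: eq_in_count => x xs /=; case zx: (zp x) => //=; symmetry; apply/eqP.
    have /andP[/eqP x0 x1] := zx; have := unit_vector2 (nP x (proj1 (sP x) xs)).
    rewrite x0 expr0n add0r => /eqP; rewrite sqrf_eq1 => /orP[]/eqP x1E.
      by apply: eq_col2; rewrite mxE.
    by move: x1; rewrite x1E oppr_gt0 ltr10.
  by apply: sub_count => x /= /andP[_ ->].
(* Vertices off the axes come in fours and (1, 0), (-1, 0) are two, so a total
   of 4 m + 2 excludes (0, 1) and (0, -1). *)
have zp0 : count zp s = 0%N by lia.
have ppm : count pp s = m by lia.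
exists [seq (x 0 0, x 1 0) | x : V <- seq.filter pp s]; split.
- by rewrite size_map size_filter.
- by move=> _ /mapP[x + ->]; rewrite mem_filter => /andP[/andP[_ /lt0r_neq0]].
move=> x xP; have xs := proj2 (sP x) xP.
have [x1|x1] := eqVneq (x 1 0) 0; first by have [->|->] := ax x xs x1; [left|right; left].
right; right.
have x0 : x 0 0 != 0.
  apply: contraTneq xs => x0; apply/negP => xs.
  have zh y : y \in s -> ~~ zp y.
    by move=> ys; apply: contra_eqN zp0 => zy; rewrite -lt0n -has_count; apply/hasP; exists y.
  have := zh x xs; have := zh _ (sN x xs); rewrite /zp !mxE x0 oppr0 eqxx /= oppr_gt0.
  by case: ltrgtP x1.
pose e1 := x 0 0 < 0; pose e2 := x 1 0 < 0.
exists (`|x 0 0|, `|x 1 0|); last first.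
  by exists e1, e2; rewrite /= /e1 /e2; split; rewrite [LHS]numEsign.
(* The image of [x] in the first quadrant; the symmetries of [s] keep it a vertex. *)
pose y : V := \col_i (if i == 0 then `|x 0 0| else `|x 1 0|).
apply/mapP; exists y; last by rewrite !mxE.
rewrite mem_filter /pp !mxE /= !normr_gt0 x0 x1 /=.
have -> : y = if e1 then (if e2 then - x else reflection (- x))
                 else (if e2 then reflection x else x).
  apply: eq_col2; rewrite /y /e1 /e2 mxE /=.
    by have [h|h] := ltrP (x 0 0) 0; rewrite ?(ltr0_norm h) ?(ger0_norm h);
      case: ifP => _; rewrite ?reflection0 ?mxE.
  by have [h|h] := ltrP (x 1 0) 0; rewrite ?(ltr0_norm h) ?(ger0_norm h);
    case: ifP => _; rewrite ?reflection1 ?mxE ?opprK.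
by case: e1 e2 => [] []; rewrite ?sR ?sN.
Qed.

End Polygon.

(** * Choosing the planes *)

Section PlaneStep.
Variables (R : realType) (d : nat).
Notation V := 'cV[R]_d.
Variable g : V -> R.
Hypotheses (gN : forall u, g (- u) = - g u)
  (gZ : forall c u, 0 < c -> g (c *: u) = c * g u) (gC : continuous g).

Lemma jointly_continuousD f1 f2 : jointly_continuous f1 -> jointly_continuous f2 ->
  jointly_continuous (fun x y : V => f1 x y + f2 x y).
Proof. by move=> c1 c2 z; apply: cvgD; [apply: c1 | apply: c2]. Qed.

Lemma jointly_continuousM f1 f2 : jointly_continuous f1 -> jointly_continuous f2 ->
  jointly_continuous (fun x y : V => f1 x y * f2 x y).
Proof. by move=> c1 c2 z; apply: cvgM; [apply: c1 | apply: c2]. Qed.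

Lemma jointly_continuous_cst c : jointly_continuous (fun _ _ : V => c).
Proof. by move=> z; apply: cvg_cst. Qed.

Lemma jointly_continuous_fst (f : V -> R) : continuous f -> jointly_continuous (fun x _ => f x).
Proof. by move=> fC z; apply: (@cvg_comp _ _ _ fst f); [exact: cvg_fst | exact: fC]. Qed.

Lemma jointly_continuous_snd (f : V -> R) : continuous f -> jointly_continuous (fun _ y => f y).
Proof. by move=> fC z; apply: (@cvg_comp _ _ _ snd f); [exact: cvg_snd | exact: fC]. Qed.

Lemma jointly_continuous_sum I (r : seq I) (F : I -> V -> V -> R) :
  (forall i, jointly_continuous (F i)) ->
  jointly_continuous (fun x y => \sum_(i <- r) F i x y).
Proof.
move=> FC; elim: r => [|i r IH].
  have -> : (fun x y : V => \sum_(i <- [::]) F i x y) = (fun _ _ => 0).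
    by apply/funext => x; apply/funext => y; rewrite big_nil.
  exact: jointly_continuous_cst.
have -> : (fun x y : V => \sum_(i <- i :: r) F i x y) =
    (fun x y => F i x y + \sum_(i <- r) F i x y).
  by apply/funext => x; apply/funext => y; rewrite big_cons.
exact: jointly_continuousD.
Qed.

Lemma continuous_coord (i : 'I_d) : continuous (fun x : V => x i 0).
Proof. exact: coord_continuous. Qed.

Lemma jointly_continuous_dot : jointly_continuous (fun x y : V => dot x y).
Proof.
apply: jointly_continuous_sum => i; apply: jointly_continuousM;
  first exact: (jointly_continuous_fst (@continuous_coord i)).
exact: (jointly_continuous_snd (@continuous_coord i)).
Qed.

Lemma jointly_continuous_sqrt f : jointly_continuous f ->
  jointly_continuous (fun x y : V => Num.sqrt (f x y)).
Proof.
move=> fC z; apply: (@cvg_comp _ _ _ (fun z => f z.1 z.2) Num.sqrt); first exact: fC.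
exact: sqrt_continuous.
Qed.

Lemma jointly_continuous_enorm_fst : jointly_continuous (fun x _ : V => enorm x).
Proof.
by apply/jointly_continuous_sqrt/jointly_continuous_sum => i; apply: jointly_continuousM;
  exact: (jointly_continuous_fst (@continuous_coord i)).
Qed.

Lemma jointly_continuous_enorm_snd : jointly_continuous (fun _ y : V => enorm y).
Proof.
by apply/jointly_continuous_sqrt/jointly_continuous_sum => i; apply: jointly_continuousM;
  exact: (jointly_continuous_snd (@continuous_coord i)).
Qed.

(* Scaling by the norm of the other argument makes [g] of the combination
   positively homogeneous in each argument. *)
Definition gcomb (a b : R) (x y : V) : R := g ((a * enorm y) *: x + (b * enorm x) *: y).

Lemma jointly_continuous_gcomb a b : jointly_continuous (gcomb a b).
Proof.
move=> z; apply: (@cvg_comp _ _ _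
  (fun z : V * V => (a * enorm z.2) *: z.1 + (b * enorm z.1) *: z.2) g);
  last exact: gC.
have n1 : enorm w.1 @[w --> z] --> enorm z.1 by exact: jointly_continuous_enorm_fst.
have n2 : enorm w.2 @[w --> z] --> enorm z.2 by exact: jointly_continuous_enorm_snd.
apply: cvgD; apply: cvgZ.
- by apply: cvgM => //; exact: cvg_cst.
- exact: cvg_fst.
- by apply: cvgM => //; exact: cvg_cst.
- exact: cvg_snd.
Qed.

Lemma gcombNl a b x y : gcomb a b (- x) y = - gcomb a (- b) x y.
Proof. by rewrite /gcomb enormN -gN scalerN opprD mulNr scaleNr opprK. Qed.

Lemma gcombNr a b x y : gcomb a b x (- y) = gcomb a (- b) x y.
Proof. by rewrite /gcomb enormN scalerN mulNr scaleNr. Qed.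

(** Zeros are found in [shell], not on the unit sphere; pulling out this positive factor passes to
    the normalised vectors. *)
Lemma gcomb_unit a b x y : x != 0 -> y != 0 -> gcomb a b x y =
  enorm x * enorm y * g (a *: ((enorm x)^-1 *: x) + b *: ((enorm y)^-1 *: y)).
Proof.
move=> /enorm_gt0 px /enorm_gt0 py.
rewrite -gZ ?mulr_gt0 // scalerDr !scalerA; congr (g (_ *: x + _ *: y)).
  by field; rewrite gt_eqF.
by field; rewrite gt_eqF.
Qed.

(** The two equations for [p] are replaced by their sum, which does not involve [b], and their
    difference. The difference at [p0] defines [b], so only [ps] contributes functions of the second
    kind. The size hypothesis allows at most d - 1 functions of the first kind and d - 2 of the
    second. *)
Lemma plane_step (prev : seq V) (p0 : R * R) (ps : seq (R * R)) :
  p0.2 != 0 -> (size prev + (size ps).+1 < d)%N ->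
  exists x y b, [/\ dot x x = 1, dot y y = 1, dot x y = 0,
    {in prev, forall a, dot x a = 0 /\ dot y a = 0} &
    {in p0 :: ps, forall p, g (p.1 *: x + p.2 *: y) = p.1 * g x + p.2 * b /\
      g (p.1 *: x - p.2 *: y) = p.1 * g x - p.2 * b}].
Proof.
move=> p02 sd.
pose F (p : R * R) (x y : V) :=
  gcomb p.1 p.2 x y + gcomb p.1 (- p.2) x y + (-2 * p.1) * gcomb 1 0 x y.
(* The differences at [p] and at [p0] should be in the ratio of [p.2] to [p0.2]; this is that
   condition with [b] eliminated and denominators cleared. *)
pose G (p : R * R) (x y : V) := p0.2 * (gcomb p.1 p.2 x y + -1 * gcomb p.1 (- p.2) x y) +
  (- p.2) * (gcomb p0.1 p0.2 x y + -1 * gcomb p0.1 (- p0.2) x y).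
have [qs qsE] : exists qs, qs = p0 :: ps by exists (p0 :: ps).
rewrite -qsE.
pose l1 := [seq (F p, (true, false)) | p <- qs] ++
  [seq ((fun x _ : V => dot x a), (true, false)) | a <- prev].
pose l2 := [seq (G p, (false, true)) | p <- ps] ++
  [seq ((fun _ y : V => dot y a), (false, true)) | a <- prev].
pose t := ((fun x y : V => dot x y), (true, true)).
have dotC1 (a : V) : continuous (fun x => dot x a).
  apply: (@lipschitz_continuous _ _ _ (d%:R * `|a|)) => u v.
  rewrite -dotBl dotC.
  by rewrite (le_trans (dot_le (normr_ge0 a) (fun i => le_mx_norm a i 0) (lexx _))) // mulrA.
have FP p : parity (F p) (true, false) /\ jointly_continuous (F p).
  split; last by do !apply: jointly_continuousD; try apply: jointly_continuousM;
    try exact: jointly_continuous_cst; exact: jointly_continuous_gcomb.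
  split=> x y; rewrite /F /= ?gcombNl ?gcombNr !(opprK, oppr0); ring.
have GP p : parity (G p) (false, true) /\ jointly_continuous (G p).
  split; last first.
    by apply: jointly_continuousD; apply: jointly_continuousM;
      try exact: jointly_continuous_cst;
      apply: jointly_continuousD; try apply: jointly_continuousM;
      try exact: jointly_continuous_cst; exact: jointly_continuous_gcomb.
  split=> x y; rewrite /G /= ?gcombNl ?gcombNr !opprK; ring.
have lP : {in l1 ++ t :: l2, forall f, parity f.1 f.2 /\ jointly_continuous f.1}.
  move=> f; rewrite mem_cat in_cons [f \in l1]mem_cat [f \in l2]mem_cat.
  move=> /or3P[/orP[]|/eqP->|/orP[]].
  - by move=> /mapP[p _ ->]; exact: FP.
  - move=> /mapP[a _ ->]; split; last exact: jointly_continuous_fst.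
    by split=> x y /=; rewrite ?dotNl ?expr1 ?expr0 ?mulN1r ?mul1r.
  - split; last exact: jointly_continuous_dot.
    by split=> x y /=; rewrite ?dotNl ?dotNr expr1 mulN1r.
  - by move=> /mapP[p _ ->]; exact: GP.
  - move=> /mapP[a _ ->]; split; last exact: jointly_continuous_snd.
    by split=> x y /=; rewrite ?dotNl ?expr1 ?expr0 ?mulN1r ?mul1r.
have [x [y [sx sy xy0]]] : exists x y, [/\ shell x, shell y &
    {in l1 ++ t :: l2, forall f, f.1 x y = 0}].
  apply: common_zero => //.
  - by rewrite size_cat !size_map qsE addnC.
  - by rewrite size_cat !size_map addnC -addnS.
  - by move=> f /lP[].
  - by move=> f; rewrite mem_cat => /orP[]/mapP[? _ ->].
  - by move=> f; rewrite mem_cat => /orP[]/mapP[? _ ->].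
  - by move=> f /lP[].
have d0 : (0 < d)%N by apply: leq_ltn_trans sd.
have shell0 (z : V) : shell z -> z != 0.
  by move=> [_ z1]; rewrite -normr_gt0; apply: lt_le_trans z1; rewrite invr_gt0 ltr0n.
have [x0 y0] := (shell0 _ sx, shell0 _ sy).
have [px py] := (enorm_gt0 x0, enorm_gt0 y0).
have xy0m f : f \in l1 ++ t :: l2 -> f.1 x y = 0 by exact: xy0.
pose x1 := (enorm x)^-1 *: x; pose y1 := (enorm y)^-1 *: y.
(* The solution of the difference equation at [p0], which exists because [p0.2] is nonzero. *)
pose b := (g (p0.1 *: x1 + p0.2 *: y1) - g (p0.1 *: x1 - p0.2 *: y1)) / (2 * p0.2).
have unit1 (z : V) : 0 < enorm z -> dot ((enorm z)^-1 *: z) ((enorm z)^-1 *: z) = 1.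
  by move=> pz; rewrite dotZl dotZr -sqr_enorm; field; rewrite gt_eqF.
exists x1, y1, b; split; [exact: unit1 | exact: unit1 | | |].
- have /= xy := xy0m t _; rewrite /x1 /y1 dotZl dotZr xy ?mulr0 //.
  by rewrite mem_cat mem_head orbT.
- move=> a ap; split; rewrite dotZl.
    have /= -> := xy0m ((fun x _ : V => dot x a), (true, false)) _; first by rewrite mulr0.
    by rewrite mem_cat [_ \in l1]mem_cat
      (map_f (fun a => ((fun x _ : V => dot x a), (true, false)))) ?orbT.
  have /= -> := xy0m ((fun _ y : V => dot y a), (false, true)) _; first by rewrite mulr0.
  by rewrite mem_cat in_cons [_ \in l2]mem_cat
    (map_f (fun a => ((fun _ y : V => dot y a), (false, true)))) ?orbT.
have nn : enorm x * enorm y != 0 by rewrite mulf_neq0 ?gt_eqF.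
have gE p q : gcomb p q x y = enorm x * enorm y * g (p *: x1 + q *: y1) by exact: gcomb_unit.
have F0 p : p \in qs ->
    g (p.1 *: x1 + p.2 *: y1) + g (p.1 *: x1 - p.2 *: y1) = 2 * p.1 * g x1.
  move=> pp; have : F p x y = 0.
    apply: (xy0m (F p, (true, false))).
    by rewrite mem_cat [_ \in l1]mem_cat (map_f (fun p => (F p, (true, false)))).
  rewrite /F !gE scale1r scale0r addr0 scaleNr => e.
  by apply: (mulfI nn); rewrite mulrDr; apply/eqP; rewrite -subr_eq0; apply/eqP; rewrite -e; ring.
have G0 p : p \in qs ->
    g (p.1 *: x1 + p.2 *: y1) - g (p.1 *: x1 - p.2 *: y1) = 2 * p.2 * b.
  rewrite qsE in_cons => /predU1P[->|pp]; first by rewrite /b; field.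
  have : G p x y = 0.
    apply: (xy0m (G p, (false, true))).
    by rewrite mem_cat in_cons [_ \in l2]mem_cat (map_f (fun p => (G p, (false, true)))) ?orbT.
  rewrite /G !gE !scaleNr => e; apply: (mulfI nn); apply: (mulfI p02).
  by apply/eqP; rewrite -subr_eq0; apply/eqP; rewrite -[RHS]e /b; field.
by move=> p pp; have := F0 p pp; have := G0 p pp; lra.
Qed.

End PlaneStep.

(** A matrix with d + 1 rows and d columns has a nonzero left kernel; a kernel vector is
    normalised. *)
Lemma orthogonal_unit_vector (R : realType) (d : nat) (a : 'I_d -> 'cV[R]_d.+1) :
  exists x, dot x x = 1 /\ forall i, dot x (a i) = 0.
Proof.
pose M := \matrix_(l < d.+1, i < d) a i l 0.
have : kermx M != 0.
  rewrite kermx_eq0 /row_free; apply: contraTneq (rank_leq_col M) => ->.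
  by rewrite ltnn.
move/rowV0Pn => [z /sub_kermxP zM z0].
pose x := z^T.
have x0 : x != 0 by rewrite /x -trmx0 (inj_eq trmx_inj).
have px := enorm_gt0 x0.
exists ((enorm x)^-1 *: x); split=> [|i].
  by rewrite dotZl dotZr -sqr_enorm; field; rewrite gt_eqF.
rewrite dotZl; have /matrixP/(_ 0 i) := zM; rewrite !mxE => zi.
by rewrite (_ : dot _ _ = 0) ?mulr0 // -[RHS]zi; apply: eq_bigr => l _; rewrite !mxE.
Qed.

(** * Assembling the planes into an orthonormal frame *)

Section Frame.
Variables (R : realType) (o k d : nat) (dE : d = (o + 2 * k)%N) (o1 : (o <= 1)%N).
Notation V := 'cV[R]_d.
Variable g : V -> R.
Hypotheses (gN : forall u, g (- u) = - g u)
  (gZ : forall c u, 0 < c -> g (c *: u) = c * g u) (gC : continuous g).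
Variable U : nat -> seq (R * R).
Hypotheses (Us : forall j, (j < k)%N -> size (U j) = (o + 2 * j).+1)
  (U0 : forall j, (j < k)%N -> {in U j, forall p, p.2 != 0}).

(** On the relevant vectors [g] agrees with the linear functional whose coordinates in the frame are
    [b]. Nothing forces [b i.+1] to be [g (a i.+1)], as (0, 1) is not a vertex. *)
Definition plane_cond (a : nat -> V) (b : nat -> R) i (u : seq (R * R)) :=
  g (a i) = b i /\ {in u, forall p,
    g (p.1 *: a i + p.2 *: a i.+1) = p.1 * b i + p.2 * b i.+1 /\
    g (p.1 *: a i - p.2 *: a i.+1) = p.1 * b i - p.2 * b i.+1}.

(** The planes are filled from the last one down, so [r] of them occupy the last [2 * r] indices.
    Plane [j] brings [o + 2 * j + 1] quadrant vertices and must be orthogonal to [2 * (k - 1 - j)]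
    vectors. These add up to d - 1 for every [j], exactly what [plane_step] can handle. *)
Lemma partial_frame r : (r <= k)%N -> exists (a : nat -> V) (b : nat -> R),
  (forall i l, (d - 2 * r <= i < d)%N -> (d - 2 * r <= l < d)%N ->
     dot (a i) (a l) = (i == l)%:R) /\
  (forall j, (k - r <= j < k)%N -> plane_cond a b (o + 2 * j)%N (U j)).
Proof.
elim: r => [|r IH] rk.
  by exists (fun _ => 0), (fun _ => 0); split=> [i l|j] h; exfalso; lia.
have [a [b [ab pc]]] := IH (ltnW rk).
pose j0 := (k - r.+1)%N; pose i0 := (o + 2 * j0)%N.
have j0k : (j0 < k)%N by rewrite /j0; lia.
have di0 : (d - 2 * r = i0.+2)%N by rewrite /i0 /j0; lia.
have := Us j0k; case UE: (U j0) => [//|p0 ps] /= [sps].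
have p02 : p0.2 != 0 by apply: (U0 j0k); rewrite UE mem_head.
pose prev := [seq a i | i <- iota i0.+2 (2 * r)].
have [] := @plane_step _ _ g gN gZ gC prev p0 ps p02.
  by rewrite size_map size_iota sps /i0 /j0; lia.
move=> x [y [c [xx yy xy xyp xyU]]].
pose a' i := if i == i0 then x else if i == i0.+1 then y else a i.
pose b' i := if i == i0 then g x else if i == i0.+1 then c else b i.
have a'0 : a' i0 = x by rewrite /a' eqxx.
have a'1 : a' i0.+1 = y by rewrite /a' eqxx gtn_eqF.
have b'0 : b' i0 = g x by rewrite /b' eqxx.
have b'1 : b' i0.+1 = c by rewrite /b' eqxx gtn_eqF.
have a'2 i : (i0.+2 <= i)%N -> a' i = a i by move=> h; rewrite /a' !gtn_eqF //; lia.
have b'2 i : (i0.+2 <= i)%N -> b' i = b i by move=> h; rewrite /b' !gtn_eqF //; lia.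
have xya i : (i0.+2 <= i < d)%N -> dot x (a i) = 0 /\ dot y (a i) = 0.
  move=> h; apply: xyp; apply: map_f; rewrite mem_iota; lia.
exists a', b'; split=> [i l hi hl|j hj].
  have cs n : (d - 2 * r.+1 <= n < d)%N -> [\/ n = i0, n = i0.+1 | (i0.+2 <= n < d)%N].
    move=> h; have [->|n0] := eqVneq n i0; first by constructor 1.
    have [->|n1] := eqVneq n i0.+1; first by constructor 2.
    by constructor 3; lia.
  case: (cs i hi) => [->|->|ih]; case: (cs l hl) => [->|->|lh];
    rewrite ?a'0 ?a'1 ?(a'2 l) ?(a'2 i) //; try lia.
  - by rewrite eqxx.
  - by rewrite ltn_eqF.
  - by rewrite (xya l lh).1 ltn_eqF //; lia.
  - by rewrite dotC gtn_eqF.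
  - by rewrite eqxx.
  - by rewrite (xya l lh).2 ltn_eqF //; lia.
  - by rewrite dotC (xya i ih).1 gtn_eqF //; lia.
  - by rewrite dotC (xya i ih).2 gtn_eqF //; lia.
  - by apply: ab; lia.
have [->|jj] := eqVneq j j0.
  by split; rewrite ?a'0 ?b'0 // UE a'1 b'1.
have jh : (k - r <= j < k)%N by rewrite /j0 in jj; lia.
have := pc j jh; rewrite /plane_cond !a'2 ?b'2 //; rewrite /i0; rewrite /j0 in jj *; lia.
Qed.

(** In odd dimension one direction remains. Any unit vector orthogonal to the planes will do,
    because its only equation is met by the choice of [b 0]. *)
Lemma full_frame : exists (a : nat -> V) (b : nat -> R),
  [/\ forall i l, (i < d)%N -> (l < d)%N -> dot (a i) (a l) = (i == l)%:R,
    forall j, (j < k)%N -> plane_cond a b (o + 2 * j)%N (U j) &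
    o = 1%N -> g (a 0%N) = b 0%N].
Proof.
have [a [b [ab pc]]] := partial_frame (leqnn k).
have [o0|o0] := eqVneq o 0%N.
  by exists a, b; split=> [i l id ld|j jk|]; [apply: ab; lia | apply: pc; lia | lia].
have oE : o = 1%N by lia.
have [x [xx xa]] : exists x, dot x x = 1 /\ forall i, (0 < i < d)%N -> dot x (a i) = 0.
  have : d = d.-1.+1 by lia.
  move: a {ab pc}; move: d.-1 => d' + dd; rewrite dd => a.
  have [x [xx xa]] := orthogonal_unit_vector (fun i : 'I_d' => a i.+1).
  exists x; split=> // -[|i] // hi; exact: (xa (Ordinal (hi : (i < d')%N))).
exists (fun i => if i == 0%N then x else a i), (fun i => if i == 0%N then g x else b i).
split=> [[|i] [|l] hi hl|j jk|_] //=.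
- by apply: xa.
- by rewrite dotC; apply: xa.
- by apply: ab; lia.
- have := pc j; rewrite /plane_cond subnn leq0n /= => /(_ jk).
  by rewrite oE.
Qed.

End Frame.

(** * The cover *)

Section Cover.
Variable R : realType.

Lemma dot_mulmx d (x y : 'cV[R]_d) : dot x y = (x^T *m y) 0 0.
Proof. by rewrite mxE; apply: eq_bigr => i _; rewrite mxE. Qed.

Lemma dot_orthogonal d (A : 'M[R]_d) (x y : 'cV[R]_d) : orthogonal_mx A ->
  dot (A *m x) (A *m y) = dot x y.
Proof.
by move=> AA; rewrite !dot_mulmx trmx_mul mulmxA -(mulmxA x^T) AA mulmx1.
Qed.

Lemma sum_place d m s (w : 'cV[R]_m) (F : nat -> R) : (s + m <= d)%N ->
  \sum_(c < d) F c * place d s w c 0 = \sum_(l < m) w l 0 * F (s + l)%N.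
Proof.
move=> sm.
transitivity (\sum_(c < d) \sum_(l < m) (if (c == s + l :> nat)%N then F c * w l 0 else 0)).
  by apply: eq_bigr => c _; rewrite mxE mulr_sumr big_mkcond.
rewrite exchange_big; apply: eq_bigr => l _; rewrite -big_mkcond.
have sl : (s + l < d)%N by apply: leq_trans sm; rewrite ltn_add2l.
by rewrite (big_pred1 (Ordinal sl)) /= 1?mulrC // => c; rewrite -val_eqE.
Qed.

Lemma convex_slabs d n (v : 'I_n -> 'cV[R]_d) : convex_set (slabs v).
Proof.
apply/convex_setW => x y /set_mem sx /set_mem sy t t0 t1; apply/mem_set => i.
rewrite (_ : dot _ _ = dot (t%:num *: x + (1 - t%:num) *: y) (v i)) // dotDl !dotZl.
apply: le_trans (ler_normD _ _) _; rewrite !normrM (gtr0_norm t0).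
rewrite (gtr0_norm (_ : 0 < 1 - t%:num)) ?subr_gt0 //.
have := sx i; have := sy i; set e := 2^-1 * _ => ye xe.
have -> : e = t%:num * e + (1 - t%:num) * e by ring.
by rewrite lerD // ler_pM2l // subr_gt0.
Qed.

(** The preimage [A^T *m x - b] of a point [x] of [X] has scalar product
    [dot x (A *m v i) - g (A *m v i)] with [v i]. [center_function] bounds it, and [A] preserves
    norms. *)
Lemma universal_cover_slabs d n (v : 'I_n -> 'cV[R]_d) :
  (forall g : 'cV[R]_d -> R, (forall u, g (- u) = - g u) ->
    (forall c u, 0 < c -> g (c *: u) = c * g u) -> continuous g ->
    exists (A : 'M[R]_d) b, orthogonal_mx A /\ forall i, g (A *m v i) = dot b (v i)) ->
  universal_cover (slabs v).
Proof.
move=> H; split; first exact: convex_slabs.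
move=> X /center_function[g [gN gZ gC gX]].
have [A [b [AA gA]]] := H g gN gZ gC.
have AA' : A *m A^T = 1%:M by exact: mulmx1C.
exists A, (A *m b); split=> // x Xx; exists (A^T *m x - b); last first.
  by rewrite mulmxBr mulmxA AA' mul1mx subrK.
move=> i; have := gX x (A *m v i) Xx.
rewrite gA /enorm dot_orthogonal //; congr (`|_| <= _).
by rewrite dotBl !dot_mulmx trmx_mul trmxK mulmxA.
Qed.

(** [o] is the dimension of the additional line, so both parities of [d] are treated at once. Planes
    are counted from 0, and [(o + 2 * j).+1] is the number of vertices per open quadrant. *)
Lemma universal_cover_planes (o k d n : nat) (v : 'I_n -> 'cV[R]_d)
    (Q : nat -> set 'cV[R]_2) : d = (o + 2 * k)%N -> (o <= 1)%N ->
  (forall j, (j < k)%N -> inscribed_symmetric_polygon (4 * (o + 2 * j).+1 + 2) (Q j)) ->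
  (forall i, (o = 1%N /\ exists c : R, v i = place d 0 (const_mx c : 'cV_1) /\ (c = 1 \/ c = -1)) \/
     exists j w, [/\ (j < k)%N, vertices (Q j) w & v i = place d (o + 2 * j) w]) ->
  universal_cover (slabs v).
Proof.
move=> dE o1 QP vP; apply: universal_cover_slabs => g gN gZ gC.
have /choice[U UP] j : exists u : seq (R * R), (j < k)%N ->
   [/\ size u = (o + 2 * j).+1, {in u, forall p, p.2 != 0} &
    forall x, vertices (Q j) x -> x = delta_mx 0 0 \/ x = - delta_mx 0 0 \/
      exists2 p, p \in u & exists e1 e2 : bool,
        x 0 0 = (-1) ^+ e1 * p.1 /\ x 1 0 = (-1) ^+ e2 * p.2].
  case: (ltnP j k) => jk; last by exists [::].
  by have [u uP] := inscribed_symmetric_polygon_quadrant (QP j jk); exists u.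
have [a [b [ab pc a0]]] := full_frame dE o1 gN gZ gC
  (fun j jk => let: And3 h _ _ := UP j jk in h) (fun j jk => let: And3 _ h _ := UP j jk in h).
(* The columns of [A] are the frame vectors, so [A] carries the coordinate planes to the chosen
   ones. *)
pose A : 'M[R]_d := \matrix_(i, l) a l i 0.
exists A, (\col_i b i); split.
  apply/matrixP => i l; rewrite !mxE -(ab i l) // /dot.
  by apply: eq_bigr => c _; rewrite !mxE.
have AE m s (w : 'cV_m) : (s + m <= d)%N ->
    A *m place d s w = \sum_(l < m) w l 0 *: a (s + l)%N.
  move=> sm; apply/matrixP => i j; rewrite (ord1 j) mxE summxE.
  under eq_bigr do rewrite [A _ _]mxE.
  rewrite (sum_place w (fun c => a c i 0) sm).
  by apply: eq_bigr => l _; rewrite mxE.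
have bE m s (w : 'cV_m) : (s + m <= d)%N ->
    dot (\col_i b i) (place d s w) = \sum_(l < m) w l 0 * b (s + l)%N.
  by move=> sm; rewrite -(sum_place w b sm); apply: eq_bigr => c _; rewrite mxE.
move=> i; have [[oE [c [-> cE]]]|[j [w [jk wQ ->]]]] := vP i.
  rewrite AE ?bE ?big_ord1; try lia.
  by rewrite mxE addn0; case: cE => ->; rewrite ?scale1r ?scaleN1r ?gN (a0 oE) ?mul1r ?mulN1r.
rewrite AE ?bE; try lia.
rewrite !big_ord_recl !big_ord0 !addr0 /= /bump /= addn0 addn1.
rewrite (_ : lift _ _ = 1); last exact: val_inj.
have [_ _ /(_ w wQ)] := UP j jk; have [g0 gU] := pc j jk.
move=> [->|[->|[p /gU[gp gm] [e1 [e2 [-> ->]]]]]].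
- by rewrite !mxE /= scale1r scale0r addr0 mul1r mul0r addr0.
- by rewrite !mxE /= oppr0 scaleN1r scale0r addr0 mulN1r mul0r addr0 gN g0.
(* Oddness of [g] reduces the four sign patterns to the two equations of [plane_cond]. *)
- case: e1; case: e2; rewrite ?expr0 ?expr1 ?mulN1r ?mul1r ?scaleNr ?mulNr //.
  + by rewrite -!opprD gN gp.
  + by rewrite (addrC (- _)) -opprB gN gm opprB addrC.
Qed.

End Cover.

Theorem theorem4 (R : realType) (P : nat -> set 'cV[R]_2) (d n : nat)
    (hd : (1 <= d)%N) (hn : n = ((d * (d + 1)) %/ 2)%N)
    (v : 'I_n -> 'cV[R]_d) :
  (forall k : nat, d = (2 * k)%N ->
     (forall j : nat, (1 <= j <= k)%N ->
        inscribed_symmetric_polygon (2 * (4 * j - 1)) (P (2 * (4 * j - 1))%N)) ->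
     plus_minus v = vertices_even P k ->
     universal_cover (slabs v))
  /\
  (forall k : nat, d = (2 * k + 1)%N ->
     (forall j : nat, (1 <= j <= k)%N ->
        inscribed_symmetric_polygon (2 * (4 * j + 1)) (P (2 * (4 * j + 1))%N)) ->
     plus_minus v = vertices_odd P k ->
     universal_cover (slabs v)).
Proof.
have vpm i : plus_minus v (v i) by exists i; left.
split=> k dE PP vE.
  (* Plane [j] counted from 0 carries polygon number [j.+1], whose vertex count 2(4(j + 1) - 1)
     equals 4(2j + 1) + 2. *)
  apply: (@universal_cover_planes R 0 k d n v (fun j => P (2 * (4 * j.+1 - 1))%N)) => //.
    move=> j jk; rewrite (_ : 4 * _ + 2 = 2 * (4 * j.+1 - 1))%N; last by lia.
    exact: PP.
  move=> i; right; have := vpm i; rewrite vE => -[[|j] //= jk [w wP <-]].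
  by exists j, w; split=> //; rewrite subn1.
apply: (@universal_cover_planes R 1 k d n v (fun j => P (2 * (4 * j.+1 + 1))%N)) => //.
- by rewrite dE addnC.
- move=> j jk; rewrite (_ : 4 * _ + 2 = 2 * (4 * j.+1 + 1))%N; last by lia.
  exact: PP.
move=> i; have := vpm i; rewrite vE => -[[w wP <-]|[[|j] //= jk [w wP <-]]].
  by left; split=> //; case: wP => ->; [exists 1|exists (-1)]; split=> //; [left|right].
by right; exists j, w; split=> //; rewrite subn1.
Qed.
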